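(* Let $(\mathcal B_{s,t})_{(s,t)\in I_{0,\infty}}$ be a continuous tensor product system of $W^*$-algebras, $(\mathcal S_{s,t})_{(s,t)\in I_{0,\infty}}$ a stationary factorizing type of states on it, and for each $t>0$ let $(U^t_{\eta,\eta'})_{\eta,\eta'\in\mathcal S_{0,t}}$ be a family of unitaries $U^t_{\eta,\eta'}:H^t_\eta\to H^t_{\eta'}$ with $U^t_{\eta,\eta}=\mathbf 1$ such that $$U^t_{\eta',\eta''}U^t_{\eta,\eta'}=U^t_{\eta,\eta''},\qquad U^t_{\eta,\eta'}\pi_\eta(a)=\pi_{\eta'}(a)U^t_{\eta,\eta'}\quad(a\in\mathcal B_{0,t}),$$ $$U^{s+t}_{\eta_s\otimes\eta_t,\eta'_s\otimes\eta'_t}V^{\eta_s,\eta_t}_{s,t}=V^{\eta'_s,\eta'_t}_{s,t}(U^s_{\eta_s,\eta'_s}\otimes U^t_{\eta_t,\eta'_t})\qquad(\eta_r,\eta'_r\in\mathcal S_{0,r},\ r=s,t).$$ Then the family of Hilbert spaces $$\mathcal E_t=\{(\psi_\eta)_{\eta\in\mathcal S_{0,t}}:\psi_\eta\in H^t_\eta,\ \psi_{\eta'}=U^t_{\eta,\eta'}\psi_\eta\ \text{for all }\eta,\eta'\in\mathcal S_{0,t}\}\ (t>0),\qquad\mathcal E_0=\mathbb C,$$ equipped with the multiplication determined by $(V_{s,t}(\psi^s\otimes\tilde\psi^t))_{\eta_s\otimes\eta_t}=V^{\eta_s,\eta_t}_{s,t}(\psi^s_{\eta_s}\otimes\tilde\psi^t_{\eta_t})$,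 is an algebraic product system.
   Context: $I_{0,\infty}=\{(s,t):0\le s<t<\infty\}$. Tensor products of $W^*$-algebras are spatial ($W^*$-) tensor products. A continuous tensor product system of $W^*$-algebras is a family $(\mathcal B_{s,t})_{(s,t)\in I_{0,\infty}}$ of $W^*$-algebras with: (W1) isomorphisms $\beta^{s,t}_r:\mathcal B_{s,t}\to\mathcal B_{s+r,t+r}$ ($r\ge0$) with $\beta^{s+r,t+r}_{r'}\circ\beta^{s,t}_r=\beta^{s,t}_{r+r'}$; (W2) isomorphisms $\gamma_{r,s,t}:\mathcal B_{r,s}\otimes\mathcal B_{s,t}\to\mathcal B_{r,t}$ ($r<s<t$) with $\gamma_{s,s',t}(\mathrm{Id}\otimes\gamma_{s',t',t})=\gamma_{s,t',t}(\gamma_{s,s',t'}\otimes\mathrm{Id})$ for $s<s'<t'<t$, and $\gamma_{s+r,s'+r,t+r}\circ(\beta^{s,s'}_r\otimes\beta^{s',t}_r)=\beta^{s,t}_r\circ\gamma_{s,s',t}$. For a state $\eta$ on a $C^*$-algebra $\mathcal A$, $(H_\eta,\pi_\eta)$ is its GNS representation and $[a]_\eta\in H_\eta$ the class of $a$; $\langle[a]_\eta,[b]_\eta\rangle=\eta(a^*b)$, $\pi_\eta(a)[b]_\eta=[ab]_\eta$. Two states are equivalent if their GNS representations are unitarily equivalent; a type of normal states is an equivalence class of normal states. Write $H^t_\eta=H_\eta$ for $\eta$ a state on $\mathcal B_{0,t}$. For $a\in\mathcal B_{0,s}$, $b\in\mathcal B_{0,t}$ put $a\otimes b=\gamma_{0,s,s+t}(a\otimes\beta^{0,t}_s(b))\in\mathcal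 B_{0,s+t}$ and for normal states $\eta_s,\eta_t$ on $\mathcal B_{0,s},\mathcal B_{0,t}$ let $\eta_s\otimes\eta_t$ denote the state $(\eta_s\otimes\eta_t\circ(\beta^{0,t}_s)^{-1})\circ\gamma_{0,s,s+t}^{-1}$ on $\mathcal B_{0,s+t}$. A stationary factorizing type of states is a family $(\mathcal S_{s,t})$ of (nonempty) sets of normal states on $\mathcal B_{s,t}$ such that: all $\eta\in\mathcal S_{s,t}$ belong to the same type; a normal state $\eta$ on $\mathcal B_{r,r+s}$ lies in $\mathcal S_{r,r+s}$ iff $\eta\circ\beta^{0,s}_r\in\mathcal S_{0,s}$; $\eta_s\in\mathcal S_{0,s},\eta_t\in\mathcal S_{0,t}$ imply $\eta_s\otimes\eta_t\in\mathcal S_{0,s+t}$; and $H^t_\eta$ is separable for all $\eta\in\mathcal S_{0,t}$. $V^{\eta_s,\eta_t}_{s,t}:H^s_{\eta_s}\otimes H^t_{\eta_t}\to H^{s+t}_{\eta_s\otimes\eta_t}$ is the unitary extending $[a]_{\eta_s}\otimes[b]_{\eta_t}\mapsto[a\otimes b]_{\eta_s\otimes\eta_t}$. The inner product of $\mathcal E_t$ is $\langle\psi,\psi'\rangle=\langle\psi_\eta,\psi'_\eta\rangle_{H^t_\eta}$ (independent of $\eta$). An algebraic product system is a pair $((\mathcal E_t)_{t\ge0},(V_{s,t})_{s,t\ge0})$ of separable Hilbert spaces with $\mathcal E_0=\mathbb C$ and unitaries $V_{s,t}:\mathcal E_s\otimes\mathcal E_t\to\mathcal E_{s+t}$, trivial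 for $s=0$ or $t=0$, with $V_{r,s+t}(\mathbf 1\otimes V_{s,t})=V_{r+s,t}(V_{r,s}\otimes\mathbf 1)$. *)

(* Defs.v *)
From HB Require Import structures.
From mathcomp Require Import all_boot all_order all_algebra.
From mathcomp Require Import complex.
From mathcomp Require Import all_classical all_reals all_analysis.

Set Implicit Arguments.
Unset Strict Implicit.
Unset Printing Implicit Defensive.

Import Order.TTheory GRing.Theory Num.Theory.
Import numFieldNormedType.Exports.
Local Open Scope classical_set_scope.
Local Open Scope ring_scope.

(** * Hilbert spaces *)

(** A complex vector space with a form; the axioms are in [is_hilbert]. *)
Record ipSpace (R : realType) := IpSpace {
  ip_car :> lmodType R[i];
  ip : ip_car -> ip_car -> R[i]
}.

Definition hnorm (R : realType) (H : ipSpace R) (x : H) : R :=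
  Num.sqrt (complex.Re (ip x x)).

(** Inner products are linear in the second argument. *)
Record is_hilbert (R : realType) (H : ipSpace R) : Prop := {
  ip_linear : forall x : H, scalar (ip x);
  ip_conj : forall x y : H, ip y x = (ip x y)^*;
  ip_ge0 : forall x : H, 0 <= ip x x;
  ip_eq0 : forall x : H, ip x x = 0 -> x = 0;
  ip_complete : forall u : nat -> H,
    (forall e : R, 0 < e -> exists N, forall m n : nat,
       (N <= m)%N -> (N <= n)%N -> hnorm (u m - u n) < e) ->
    exists x : H, forall e : R, 0 < e -> exists N, forall n : nat,
       (N <= n)%N -> hnorm (u n - x) < e
}.

Definition is_separable (R : realType) (H : ipSpace R) : Prop :=
  exists u : nat -> H, forall (x : H) (e : R), 0 < e ->
    exists n, hnorm (x - u n) < e.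

Definition dense_span (R : realType) (H : ipSpace R) (D : set H) : Prop :=
  forall (x : H) (e : R), 0 < e ->
    exists n (c : 'I_n -> R[i]) (v : 'I_n -> H),
      (forall i, D (v i)) /\ hnorm (x - \sum_(i < n) c i *: v i) < e.

Definition bounded_op (R : realType) (H K : ipSpace R) (T : H -> K) : Prop :=
  linear T /\ exists M : R, forall x, hnorm (T x) <= M * hnorm x.

Definition unitary_op (R : realType) (H K : ipSpace R) (T : H -> K) : Prop :=
  [/\ linear T, forall x y, ip (T x) (T y) = ip x y
    & forall y, exists x, T x = y].

(** The one-dimensional Hilbert space. *)
Definition Cspace (R : realType) : ipSpace R :=
  @IpSpace R (R[i]^o : lmodType R[i]) (fun x y : R[i] => x^* * y).

Definition ip_cast (R : realType) (H K : ipSpace R) (e : H = K) : H -> K :=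
  match e in _ = L return H -> L with erefl => id end.

(** A choice of Hilbert space tensor products: each product is determined up
    to a unique unitary compatible with elementary tensors.  Nothing is
    required of [ht H K] when [H] or [K] is not a Hilbert space. *)
Record hilbert_tensor (R : realType) := {
  ht :> ipSpace R -> ipSpace R -> ipSpace R;
  ht_pure : forall H K : ipSpace R, H -> K -> ht H K;
  ht_hilbert : forall H K, is_hilbert H -> is_hilbert K ->
    is_hilbert (ht H K);
  ht_linearl : forall H K, is_hilbert H -> is_hilbert K ->
    forall y : K, linear (fun x : H => ht_pure x y);
  ht_linearr : forall H K, is_hilbert H -> is_hilbert K ->
    forall x : H, linear (fun y : K => ht_pure x y);
  ht_ip : forall H K, is_hilbert H -> is_hilbert K ->
    forall (x x' : H) (y y' : K),
      ip (ht_pure x y) (ht_pure x' y') = ip x x' * ip y y';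
  ht_dense : forall H K, is_hilbert H -> is_hilbert K ->
    dense_span [set z | exists (x : H) (y : K), z = ht_pure x y]
}.

(** Here and below, [xget d P] is used as a definite description: the element
    satisfying [P], with the irrelevant default value [d] if there is none. *)

(** The operator tensor product of two bounded operators. *)
Definition ht_map (R : realType) (HT : hilbert_tensor R) (H K H' K' : ipSpace R)
    (A : H -> H') (B : K -> K') : HT H K -> HT H' K' :=
  xget (fun=> 0) [set T : HT H K -> HT H' K' | bounded_op T /\
    forall x y, T (ht_pure HT x y) = ht_pure HT (A x) (B y)].

(** The canonical identification of (H (x) K) (x) L with H (x) (K (x) L). *)
Definition ht_assoc (R : realType) (HT : hilbert_tensor R) (H K L : ipSpace R) :
    HT (HT H K) L -> HT H (HT K L) :=
  xget (fun=> 0) [set T : HT (HT H K) L -> HT H (HT K L) | bounded_op T /\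
    forall x y z, T (ht_pure HT (ht_pure HT x y) z) =
                  ht_pure HT x (ht_pure HT y z)].

(** * W*-algebras *)

(** Unital *-algebras over the complex numbers.  The zero algebra is excluded;
    it has no states. *)
Record starAlg (R : realType) := {
  sa_car :> algType R[i];
  star : sa_car -> sa_car;
  starD : forall a b, star (a + b) = star a + star b;
  starZ : forall (c : R[i]) a, star (c *: a) = c^* *: star a;
  starM : forall a b, star (a * b) = star b * star a;
  starK : involutive star
}.

Record is_rep (R : realType) (A : starAlg R) (H : ipSpace R)
    (p : A -> H -> H) : Prop := {
  rep_bounded : forall a, bounded_op (p a);
  rep_linear : forall (c : R[i]) a b x, p (c *: a + b) x = c *: p a x + p b x;
  rep_mul : forall a b x, p (a * b) x = p a (p b x);
  rep_one : forall x, p 1 x = x;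
  rep_star : forall a x y, ip (p (star a) x) y = ip x (p a y)
}.

Definition commutant (R : realType) (H : ipSpace R) (D : set (H -> H)) :
    set (H -> H) :=
  [set T | bounded_op T /\ forall W, D W -> T \o W = W \o T].

Definition square_summable (R : realType) (H : ipSpace R) (u : nat -> H) : Prop :=
  cvgn (series (fun n => hnorm (u n) ^+ 2)).

(** [p] is a *-isomorphism of [A] onto a von Neumann algebra on [H], and the
    functionals in [N] are those that are ultraweakly continuous on its image,
    i.e. a |-> sum_n <xi_n, p(a) zeta_n>. *)
Record is_realization (R : realType) (A : starAlg R) (N : set (A -> R[i]))
    (H : ipSpace R) (p : A -> H -> H) : Prop := {
  rz_hilbert : is_hilbert H;
  rz_rep : is_rep p;
  rz_inj : injective p;
  rz_bicommutant : range p = commutant (commutant (range p));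
  rz_normal : forall f : A -> R[i], N f <->
    exists xi zeta : nat -> H,
      [/\ square_summable xi, square_summable zeta
        & forall a, series (fun n => ip (xi n) (p a (zeta n)) : R[i]^o) @ \oo
                  --> (f a : R[i]^o)]
}.

(** A W*-algebra is a *-algebra that is *-isomorphic to a von Neumann algebra.
    The predual [w_normal] is uniquely determined by the *-algebra. *)
Record wstar (R : realType) := {
  w_alg :> starAlg R;
  w_normal : set (w_alg -> R[i]);
  w_realizable : exists (H : ipSpace R) (p : w_alg -> H -> H),
    is_realization w_normal p
}.

(** *-isomorphisms are automatically normal; [iso_normal] records it. *)
Record is_wiso (R : realType) (A B : wstar R) (f : A -> B) : Prop := {
  iso_linear : linear f;
  iso_mul : forall a b, f (a * b) = f a * f b;
  iso_one : f 1 = 1;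
  iso_star : forall a, f (star a) = star (f a);
  iso_bij : bijective f;
  iso_normal : forall g : B -> R[i],
    w_normal (g : B -> R[i]) <-> w_normal (g \o f : A -> R[i])
}.

(** [T], with the elementary tensors [e a b], is the spatial tensor product of
    [M] and [N]: for realizations of [M] on [H] and of [N] on [K], it is
    realized on H (x) K as the von Neumann algebra generated by the operators
    a (x) b. *)
Definition is_spatial_tensor (R : realType) (HT : hilbert_tensor R)
    (M N T : wstar R) (e : M -> N -> T) : Prop :=
  exists (H K : ipSpace R) (p : M -> H -> H) (q : N -> K -> K)
         (r : T -> HT H K -> HT H K),
    [/\ is_realization (@w_normal R M) p, is_realization (@w_normal R N) q,
        is_realization (@w_normal R T) r,
        forall a b x y,
          r (e a b) (ht_pure HT x y) = ht_pure HT (p a x) (q b y)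
      & range r = commutant (commutant [set W | exists a b, W = r (e a b)])].

(** A choice of spatial tensor products of W*-algebras. *)
Record wstar_tensor (R : realType) (HT : hilbert_tensor R) := {
  wt :> wstar R -> wstar R -> wstar R;
  wt_pure : forall M N : wstar R, M -> N -> wt M N;
  wt_spatial : forall M N, is_spatial_tensor HT (@wt_pure M N)
}.

(** The tensor product of two normal functionals. *)
Definition wt_functional (R : realType) (HT : hilbert_tensor R)
    (WT : wstar_tensor HT) (M N : wstar R) (f : M -> R[i]) (g : N -> R[i]) :
    WT M N -> R[i] :=
  xget (fun=> 0) [set h : WT M N -> R[i] | w_normal h /\
    forall a b, h (wt_pure WT a b) = f a * g b].

Arguments wt_functional {R HT} WT {M N} f g _.

(** * States and GNS representations *)

Definition is_state (R : realType) (A : starAlg R) (f : A -> R[i]) : Prop :=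
  [/\ scalar f, forall a, 0 <= f (star a * a) & f 1 = 1].

Definition is_normal_state (R : realType) (A : wstar R) (f : A -> R[i]) : Prop :=
  is_state f /\ w_normal f.

Record gns_data (R : realType) (A : wstar R) := {
  gns_space :> ipSpace R;
  gns_pi : A -> gns_space -> gns_space;
  gns_class : A -> gns_space
}.

Record is_gns (R : realType) (A : wstar R) (f : A -> R[i])
    (G : gns_data A) : Prop := {
  gns_hilbert : is_hilbert G;
  gns_rep : is_rep (@gns_pi R A G);
  gns_linear : linear (@gns_class R A G);
  gns_ip : forall a b, ip (gns_class G a) (gns_class G b) = f (star a * b);
  gns_act : forall a b, gns_pi a (gns_class G b) = gns_class G (a * b);
  gns_dense : dense_span (range (@gns_class R A G))
}.

(** A choice of GNS representations, each being determined by the state up to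
    a unique unitary. *)
Record gns_choice (R : realType) := {
  gns :> forall A : wstar R, (A -> R[i]) -> gns_data A;
  gnsP : forall (A : wstar R) (f : A -> R[i]), is_state f -> is_gns f (gns f)
}.
Arguments gns {R} g {A} f.

Definition state_equiv (R : realType) (GNS : gns_choice R) (A : wstar R)
    (f g : A -> R[i]) : Prop :=
  exists W : gns GNS f -> gns GNS g, unitary_op W /\
    forall a x, W (gns_pi a x) = gns_pi a (W x).

(** * Continuous tensor product systems of W*-algebras *)

Definition is_shift (R : realType) (r s t s' t' : R) : Prop :=
  [/\ 0 <= r, s' = s + r & t' = t + r].

(** [ct_alg s t] is B_{s,t}; only the values for 0 <= s < t are relevant.
    The isomorphism beta^{s,t}_r is [ct_beta s t s' t'] for s' = s + r and
    t' = t + r: indexing it by its target instead of r avoids transports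
    between, e.g., B_{0+s,t+s} and B_{s,s+t}.  The identities in (W2) are
    between normal maps on spatial tensor products, and are stated on the
    elementary tensors, which generate. *)
Record ctps (R : realType) (HT : hilbert_tensor R) (WT : wstar_tensor HT) := {
  ct_alg :> R -> R -> wstar R;
  ct_beta : forall s t s' t' : R, ct_alg s t -> ct_alg s' t';
  ct_gamma : forall r s t : R, WT (ct_alg r s) (ct_alg s t) -> ct_alg r t;
  ct_beta_iso : forall r s t s' t' : R, 0 <= s -> s < t ->
    is_shift r s t s' t' -> is_wiso (@ct_beta s t s' t');
  ct_beta_comp : forall r r' s t s1 t1 s2 t2 : R, 0 <= s -> s < t ->
    is_shift r s t s1 t1 -> is_shift r' s1 t1 s2 t2 ->
    forall a, @ct_beta s1 t1 s2 t2 (@ct_beta s t s1 t1 a) = @ct_beta s t s2 t2 a;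
  ct_gamma_iso : forall r s t : R, 0 <= r -> r < s -> s < t ->
    is_wiso (@ct_gamma r s t);
  ct_gamma_assoc : forall s s' t' t : R, 0 <= s -> s < s' -> s' < t' -> t' < t ->
    forall a b c,
      @ct_gamma s s' t (wt_pure WT a (@ct_gamma s' t' t (wt_pure WT b c))) =
      @ct_gamma s t' t (wt_pure WT (@ct_gamma s s' t' (wt_pure WT a b)) c);
  ct_gamma_beta : forall r s s' t s1 s1' t1 : R, 0 <= s -> s < s' -> s' < t ->
    is_shift r s s' s1 s1' -> is_shift r s' t s1' t1 ->
    forall a b,
      @ct_gamma s1 s1' t1 (wt_pure WT (@ct_beta s s' s1 s1' a)
                                      (@ct_beta s' t s1' t1 b)) =
      @ct_beta s t s1 t1 (@ct_gamma s s' t (wt_pure WT a b))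
}.

Arguments ct_beta {R HT WT} _ s t s' t' _.
Arguments ct_gamma {R HT WT} _ r s t _.

(** The inverse of a bijection. *)
Definition inv_of (R : realType) (A B : wstar R) (f : A -> B) (b : B) : A :=
  xget 0 [set a : A | f a = b].

Section Systems.
Context (R : realType) (HT : hilbert_tensor R) (WT : wstar_tensor HT)
  (GNS : gns_choice R) (B : ctps WT).

Definition el_tensor (s t : R) (a : B 0 s) (b : B 0 t) : B 0 (s + t) :=
  ct_gamma B 0 s (s + t) (wt_pure WT a (ct_beta B 0 t s (s + t) b)).

Definition st_tensor (s t : R) (f : B 0 s -> R[i]) (g : B 0 t -> R[i]) :
    B 0 (s + t) -> R[i] :=
  wt_functional WT f (g \o inv_of (ct_beta B 0 t s (s + t)))
    \o inv_of (ct_gamma B 0 s (s + t)).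

Record stationary_factorizing (S : forall s t : R, set (B s t -> R[i])) : Prop := {
  sf_nonempty : forall s t : R, 0 <= s -> s < t -> S s t !=set0;
  sf_normal : forall (s t : R) f, 0 <= s -> s < t -> S s t f -> is_normal_state f;
  sf_type : forall (s t : R) f g, 0 <= s -> s < t -> S s t f -> S s t g ->
    state_equiv GNS f g;
  sf_stationary : forall (r s : R) (f : B r (r + s) -> R[i]), 0 <= r -> 0 < s ->
    is_normal_state f ->
    (S r (r + s) f <-> S 0 s (f \o ct_beta B 0 s r (r + s)));
  sf_tensor : forall (s t : R) f g, 0 < s -> 0 < t -> S 0 s f -> S 0 t g ->
    S 0 (s + t) (st_tensor f g);
  sf_separable : forall (t : R) f, 0 < t -> S 0 t f -> is_separable (gns GNS f)
}.

(** The unitary V^{f,g}_{s,t} between GNS spaces. *)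
Definition gns_V (s t : R) (f : B 0 s -> R[i]) (g : B 0 t -> R[i]) :
    HT (gns GNS f) (gns GNS g) -> gns GNS (st_tensor f g) :=
  xget (fun=> 0)
    [set W : HT (gns GNS f) (gns GNS g) -> gns GNS (st_tensor f g) |
      unitary_op W /\
      forall a b, W (ht_pure HT (gns_class (gns GNS f) a) (gns_class (gns GNS g) b))
                  = gns_class (gns GNS (st_tensor f g)) (el_tensor a b)].

End Systems.

(** * Coherent families of vectors *)

Section Coherent.
Context (R : realType) (I : Type) (H : I -> ipSpace R)
  (U : forall i j, {linear H i -> H j}).

Record coherent := Coherent {
  coh_fun :> forall i, H i;
  cohP : forall i j, coh_fun j = U i j (coh_fun i)
}.

Lemma coh_ext (x y : coherent) : (forall i, x i = y i) -> x = y.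
Proof.
case: x y => [x xP] [y yP] /= e.
have {}e : x = y by apply/functional_extensionality_dep.
by subst y; congr Coherent; apply: Prop_irrelevance.
Qed.

Definition coh0 : coherent :=
  @Coherent (fun=> 0) (fun i j => esym (linear0 (U i j))).

Lemma cohN_subproof (x : coherent) i j : - x j = U i j (- x i).
Proof. by rewrite linearN -cohP. Qed.
Definition cohN x : coherent := Coherent (cohN_subproof x).

Lemma cohD_subproof (x y : coherent) i j : x j + y j = U i j (x i + y i).
Proof. by rewrite linearD -!cohP. Qed.
Definition cohD x y : coherent := Coherent (cohD_subproof x y).

Lemma cohZ_subproof (c : R[i]) (x : coherent) i j : c *: x j = U i j (c *: x i).
Proof. by rewrite linearZ -cohP. Qed.
Definition cohZ c x : coherent := Coherent (cohZ_subproof c x).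

HB.instance Definition _ := gen_eqMixin coherent.
HB.instance Definition _ := gen_choiceMixin coherent.

Lemma cohDA : associative cohD.
Proof. by move=> x y z; apply: coh_ext => i; exact: addrA. Qed.
Lemma cohDC : commutative cohD.
Proof. by move=> x y; apply: coh_ext => i; exact: addrC. Qed.
Lemma coh0D : left_id coh0 cohD.
Proof. by move=> x; apply: coh_ext => i; exact: add0r. Qed.
Lemma cohND : left_inverse coh0 cohN cohD.
Proof. by move=> x; apply: coh_ext => i; exact: addNr. Qed.

HB.instance Definition _ :=
  GRing.isZmodule.Build coherent cohDA cohDC coh0D cohND.

Lemma cohZA (c d : R[i]) (x : coherent) : cohZ c (cohZ d x) = cohZ (c * d) x.
Proof. by apply: coh_ext => i; exact: scalerA. Qed.
Lemma coh1Z : left_id 1 cohZ.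
Proof. by move=> x; apply: coh_ext => i; exact: scale1r. Qed.
Lemma cohZDr : right_distributive cohZ +%R.
Proof. by move=> c x y; apply: coh_ext => i; exact: scalerDr. Qed.
Lemma cohZDl (x : coherent) : {morph cohZ^~ x : c d / c + d}.
Proof. by move=> c d; apply: coh_ext => i; exact: scalerDl. Qed.

HB.instance Definition _ :=
  GRing.Zmodule_isLmodule.Build R[i] coherent cohZA coh1Z cohZDr cohZDl.

(** The inner product is the common value of the <x_i, y_i>. *)
Definition coh_space : ipSpace R :=
  @IpSpace R (coherent : lmodType R[i])
    (fun x y => xget 0 [set z : R[i] | forall i, z = ip (x i) (y i)]).

End Coherent.

(** * The spaces E_t *)

Section Espace.
Context (R : realType) (HT : hilbert_tensor R) (WT : wstar_tensor HT)
  (GNS : gns_choice R) (B : ctps WT)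
  (S : forall s t : R, set (B s t -> R[i]))
  (U : forall (t : R) (f g : B 0 t -> R[i]), {linear gns GNS f -> gns GNS g}).
Arguments U : clear implicits.

Definition S0 (t : R) : Type := {f : B 0 t -> R[i] | S f}.

Definition Efam (t : R) : ipSpace R :=
  @coh_space R (S0 t) (fun f => gns GNS (sval f))
    (fun f g => U t (sval f) (sval g)).

Definition Ebool (t : R) (b : bool) : ipSpace R :=
  if b then Efam t else Cspace R.

(** E_t for t > 0, and the complex numbers for t = 0 (the values at negative
    [t] are irrelevant). *)
Definition Espace (t : R) : ipSpace R := Ebool t (0 < t).

Definition Ebool_comp (t : R) (b : bool) :
    is_true b -> Ebool t b -> forall f : S0 t, gns GNS (sval f) :=
  match b return is_true b -> Ebool t b -> forall f : S0 t, gns GNS (sval f) with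
  | true => fun _ psi => coh_fun psi
  | false => fun h => match notF h with end
  end.

(** The component psi_f of psi in E_t, for t > 0. *)
Definition Ecomp (t : R) (t0 : 0 < t) (psi : Espace t) (f : S0 t) :
    gns GNS (sval f) := Ebool_comp t0 psi f.

(** (W (psi (x) phi))_{f (x) g} = V^{f,g}_{s,t} (psi_f (x) phi_g) *)
Definition multiplication_rule (s t : R)
    (W : HT (Espace s) (Espace t) -> Espace (s + t)) : Prop :=
  forall (s0 : 0 < s) (t0 : 0 < t) (st0 : 0 < s + t)
    (psi : Espace s) (phi : Espace t) (f : S0 s) (g : S0 t)
    (fg : S (st_tensor (sval f) (sval g))),
  Ecomp st0 (W (ht_pure HT psi phi)) (exist _ _ fg) =
  gns_V (ht_pure HT (Ecomp s0 psi f) (Ecomp t0 phi g)).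

End Espace.

(** * Algebraic product systems *)

(** [aps_assoc] is V_{r+s,t} (V_{r,s} (x) 1) = V_{r,s+t} (1 (x) V_{s,t}), up
    to the canonical identification of the threefold tensor products. *)
Record is_product_system (R : realType) (HT : hilbert_tensor R)
    (E : R -> ipSpace R) (V : forall s t : R, HT (E s) (E t) -> E (s + t)) :
    Prop := {
  aps_hilbert : forall t : R, 0 <= t -> is_hilbert (E t);
  aps_separable : forall t : R, 0 <= t -> is_separable (E t);
  aps_zero : Cspace R = E 0;
  aps_unitary : forall s t : R, 0 <= s -> 0 <= t -> unitary_op (@V s t);
  aps_triviall : forall t : R, 0 <= t -> forall (c : R[i]) (x : E t),
    V 0 t (ht_pure HT (@ip_cast _ (Cspace R) (E 0) aps_zero c) x) =
    ip_cast (congr1 E (esym (add0r t))) (c *: x);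
  aps_trivialr : forall t : R, 0 <= t -> forall (c : R[i]) (x : E t),
    V t 0 (ht_pure HT x (@ip_cast _ (Cspace R) (E 0) aps_zero c)) =
    ip_cast (congr1 E (esym (addr0 t))) (c *: x);
  aps_assoc : forall r s t : R, 0 <= r -> 0 <= s -> 0 <= t ->
    forall x : HT (HT (E r) (E s)) (E t),
    V (r + s) t (ht_map (@V r s) id x) =
    ip_cast (congr1 E (addrA r s t)) (V r (s + t) (ht_map id (@V s t) (ht_assoc x)))
}.

(* Main.v *)
(** All spaces [E_t] and multiplications are read off one component: evaluation
    at a state identifies [E_t] with a GNS space, and [V_{s,t}] is the isometry
    given by [[a] (x) [b] |-> [a (x) b]], which is associative because the states
    [(f (x) g) (x) h] and [f (x) (g (x) h)] agree.

    Both the surjectivity of [V_{s,t}] and the equality of these two states need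
    the elementary tensors [a (x) b] to determine normal functionals on a spatial
    tensor product.  This is the ultrastrong density of a *-algebra [A0] in its
    bicommutant, and it does not require amplifying the Hilbert space [H]: given
    a square-summable [xi], consider the GNS space [G] of the normalized state
    [t |-> \sum_n <xi n, t (xi n)>].  The maps [V n : [t] |-> t (xi n)] from [G]
    to [H] are bounded, intertwine the representations and are jointly injective.
    If [J n] is the adjoint of [V n] restricted to the closed span of [[A0]],
    then [V m \o J n] lies in the commutant of [A0], hence commutes with the
    bicommutant; so the [J n] intertwine the whole bicommutant, which forces the
    orthogonal complement of [[A0]] to vanish. *)

Require Import Defs.
From HB Require Import structures.
From mathcomp Require Import all_boot all_order all_algebra.
From mathcomp Require Import complex ring lra.
From mathcomp Require Import all_classical all_reals all_analysis.

Set Implicit Arguments.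
Unset Strict Implicit.
Unset Printing Implicit Defensive.

Import Order.TTheory GRing.Theory Num.Theory.
Import numFieldNormedType.Exports.
Local Open Scope classical_set_scope.
Local Open Scope ring_scope.

(** * Semi-inner products *)

(** The density statement serves twice. For surjectivity of [gns_V] it is applied to [st_tensor f g]
    itself, composed with [gamma], and gives approximation in the GNS norm. For the equality of the
    two threefold states, the left legs of the tensors [(a (x) b) (x) c] run only through a subset
    of the left algebra that determines normal functionals. [realized_gen] shows that this is
    enough: in the relation [X (a (x) c) = (a (x) c) X], every matrix coefficient of either side is
    a vector functional of [a], so the relation spreads from a determining set to all [a]. Hence
    [determining] can be iterated over tensor products.

    The second obstacle is formal: [r + (s + t)] and [r + s + t] index different types, and [E_0]
    equals the complex line only propositionally. Transports are therefore kept outside, and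
    associativity is tested on dense families where both sides are explicit. *)

Section ComplexNumbers.
Context (R : realType).
Implicit Types (z w : R[i]) (a b : R).

Definition cabs z : R := Normc.normc z.

Lemma ReD z w : complex.Re (z + w) = complex.Re z + complex.Re w.
Proof. by case: z w => ? ? []. Qed.
Lemma ImD z w : complex.Im (z + w) = complex.Im z + complex.Im w.
Proof. by case: z w => ? ? []. Qed.
Lemma ReN z : complex.Re (- z) = - complex.Re z.
Proof. by case: z. Qed.
Lemma ImN z : complex.Im (- z) = - complex.Im z.
Proof. by case: z. Qed.
Lemma Re_conj z : complex.Re z^* = complex.Re z.
Proof. by case: z. Qed.
Lemma Im_conj z : complex.Im z^* = - complex.Im z.
Proof. by case: z. Qed.
Lemma ReM z w : complex.Re (z * w) =
  complex.Re z * complex.Re w - complex.Im z * complex.Im w.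
Proof. by case: z w => ? ? []. Qed.
Lemma ImM z w : complex.Im (z * w) =
  complex.Re z * complex.Im w + complex.Im z * complex.Re w.
Proof. by case: z w => ? ? []. Qed.
Lemma ReZ a z : complex.Re (a%:C%C * z) = a * complex.Re z.
Proof. by rewrite ReM /= mul0r subr0. Qed.
Lemma ImZ a z : complex.Im (a%:C%C * z) = a * complex.Im z.
Proof. by rewrite ImM /= mul0r addr0. Qed.
Lemma conj_real a : (a%:C%C)^* = a%:C%C :> R[i].
Proof. exact: conjc_real. Qed.
Lemma complex_ext z w :
  complex.Re z = complex.Re w -> complex.Im z = complex.Im w -> z = w.
Proof. by case: z w => ? ? [? ?] /= -> ->. Qed.

Lemma norm_cabs z : `|z| = (cabs z)%:C%C.
Proof. by []. Qed.
Lemma cabs_sq z : cabs z ^+ 2 = complex.Re z ^+ 2 + complex.Im z ^+ 2.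
Proof. by case: z => a b; rewrite /cabs /= sqr_sqrtr // addr_ge0 ?sqr_ge0. Qed.
Lemma cabs_ge0 z : 0 <= cabs z.
Proof. by case: z => a b; exact: sqrtr_ge0. Qed.
Lemma cabsM z w : cabs (z * w) = cabs z * cabs w.
Proof. exact: Normc.normcM. Qed.
Lemma cabsD z w : cabs (z + w) <= cabs z + cabs w.
Proof. exact: le_normcD. Qed.
Lemma cabs_conj z : cabs z^* = cabs z.
Proof. by case: z => a b; rewrite /cabs /= sqrrN. Qed.
Lemma cabsN z : cabs (- z) = cabs z.
Proof. by case: z => a b; rewrite /cabs /= !sqrrN. Qed.
Lemma cabsB z w : cabs (z - w) = cabs (w - z).
Proof. by rewrite -cabsN opprB. Qed.
Lemma cabs_eq0 z : cabs z = 0 -> z = 0.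
Proof. exact: Normc.eq0_normc. Qed.
Lemma cabs0 : cabs 0 = 0.
Proof. exact: Normc.normc0. Qed.
Lemma cabs_real a : cabs a%:C%C = `|a|.
Proof. by rewrite /cabs /= expr0n /= addr0 sqrtr_sqr. Qed.
Lemma le_Re_cabs z : `|complex.Re z| <= cabs z.
Proof. by rewrite -sqrtr_sqr; case: z => a b; rewrite ler_wsqrtr //= lerDl sqr_ge0. Qed.
Lemma le_Im_cabs z : `|complex.Im z| <= cabs z.
Proof. by rewrite -sqrtr_sqr; case: z => a b; rewrite ler_wsqrtr //= lerDr sqr_ge0. Qed.
Lemma mul_conj z : z^* * z = (cabs z ^+ 2)%:C%C.
Proof.
rewrite cabs_sq; apply: complex_ext; rewrite ?(ReM,ImM,Re_conj,Im_conj) /=; ring.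
Qed.
Lemma Re_ge0 z : 0 <= z -> 0 <= complex.Re z.
Proof. by rewrite lecE => /andP[]. Qed.
Lemma ge0_real z : 0 <= z -> z = (complex.Re z)%:C%C.
Proof. by rewrite lecE => /andP[/eqP e _]; exact: complex_ext. Qed.

(** Closure arguments below typically end in an error linear in [e]; the restriction [e <= 1] lets
    products of errors be absorbed into such a bound. *)
Lemma le_eps a b M :
  (forall e : R, 0 < e -> e <= 1 -> a <= b + e * M) -> a <= b.
Proof.
move=> h; rewrite leNgt; apply/negP => ab.
have N0 : 0 < `|M| + 1 by rewrite ltr_wpDl.
set d := (a - b) / (2 * (`|M| + 1)).
have d0 : 0 < d by rewrite divr_gt0 ?mulr_gt0 ?subr_gt0.
have eq : d * (2 * (`|M| + 1)) = a - b by rewrite mulfVK // gt_eqF // mulr_gt0.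
have h2 e : 0 < e -> e <= d -> e <= 1 -> a <= b + e * M -> False.
  move=> e0 ed e1.
  have : e * M <= d * `|M| by rewrite (le_trans (ler_norm _)) // normrM gtr0_norm // ler_wpM2r.
  lra.
have [d1|d1] := leP d 1; first exact: (h2 d d0 (lexx _) d1 (h _ d0 d1)).
exact: (h2 1 ltr01 (ltW d1) (lexx _) (h _ ltr01 (lexx _))).
Qed.

Lemma cabs_le0 z M :
  (forall e : R, 0 < e -> e <= 1 -> cabs z <= e * M) -> z = 0.
Proof.
move=> h; apply/cabs_eq0/eqP; rewrite eq_le cabs_ge0 andbT.
by apply: (@le_eps _ _ M) => e e0 e1; rewrite add0r h.
Qed.

(** Rotating by [u] turns a bound on real parts into one on absolute values; Cauchy-Schwarz follows
    from [Re_ip_le] in this way. *)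
Lemma phase z : exists u : R[i], cabs u = 1 /\ u * z = (cabs z)%:C%C.
Proof.
have [->|z0] := eqVneq z 0.
  by exists 1; rewrite /cabs Normc.normc1 Normc.normc0 mulr0.
have n0 : cabs z != 0 by apply: contraNneq z0 => /cabs_eq0 ->.
exists (((cabs z)^-1)%:C%C * z^*); split.
  by rewrite cabsM cabs_real cabs_conj ger0_norm ?invr_ge0 ?cabs_ge0 ?mulVf.
rewrite -mulrA mul_conj; apply: complex_ext; rewrite ?(ReZ,ImZ) /= ?mulr0 //.
by rewrite expr2 mulKf.
Qed.

End ComplexNumbers.

Section LinearFunctions.
Context (K : pzRingType) (L M : lmodType K) (f : L -> M) (hf : linear f).

Lemma lin0 : f 0 = 0.
Proof. by have := hf (-1) 0 0; rewrite scaler0 addr0 scaleN1r addNr. Qed.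
Lemma linZ a x : f (a *: x) = a *: f x.
Proof. by have := hf a x 0; rewrite lin0 !addr0. Qed.
Lemma linD x y : f (x + y) = f x + f y.
Proof. by have := hf 1 x y; rewrite !scale1r. Qed.
Lemma linN x : f (- x) = - f x.
Proof. by rewrite -scaleN1r linZ scaleN1r. Qed.
Lemma linB x y : f (x - y) = f x - f y.
Proof. by rewrite linD linN. Qed.
Lemma lin_sum n (c : 'I_n -> K) (v : 'I_n -> L) :
  f (\sum_(i < n) c i *: v i) = \sum_(i < n) c i *: f (v i).
Proof.
elim/big_ind2: _ => [|x1 x2 y1 y2 <- <-|i _]; first exact: lin0.
- exact: linD.
- exact: linZ.
Qed.

End LinearFunctions.

Section Span.
Context (K : pzRingType) (L : lmodType K).

Definition submod (D : set L) :=
  D 0 /\ forall a x y, D x -> D y -> D (a *: x + y).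

Definition lspan (D : set L) : set L := [set x | exists n (c : 'I_n -> K)
  (v : 'I_n -> L), (forall i, D (v i)) /\ x = \sum_(i < n) c i *: v i].

Lemma submod_sum (D : set L) n (c : 'I_n -> K) (v : 'I_n -> L) :
  submod D -> (forall i, D (v i)) -> D (\sum_(i < n) c i *: v i).
Proof.
move=> [D0 DD] h; elim/big_rec: _ => // i x _ Dx; exact: DD.
Qed.

Lemma lspan_submod (D : set L) : submod (lspan D).
Proof.
split; first by exists 0%N, (fun=> 0), (fun=> 0); split=> [[]//|]; rewrite big_ord0.
move=> a x y [n [c [v [vD ->]]]] [m [d [w [wD ->]]]].
exists (n + m)%N, (fun i => match fintype.split i with inl j => a * c j | inr j => d j end),
  (fun i => match fintype.split i with inl j => v j | inr j => w j end); split.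
  by move=> i; case: (fintype.split i).
rewrite big_split_ord /=; congr (_ + _).
  rewrite scaler_sumr; apply: eq_bigr => i _.
  by rewrite (unsplitK (inl i : 'I_n + 'I_m)) scalerA.
by apply: eq_bigr => i _; rewrite (unsplitK (inr i : 'I_n + 'I_m)).
Qed.

Lemma sub_lspan (D : set L) x : D x -> lspan D x.
Proof.
move=> Dx; exists 1%N, (fun=> 1), (fun=> x); split=> //.
by rewrite big_ord_recl big_ord0 addr0 scale1r.
Qed.

Lemma lspan_ind (D E : set L) : submod E -> D `<=` E -> lspan D `<=` E.
Proof.
by move=> hE DE _ [n [c [v [vD ->]]]]; apply: submod_sum => // i; apply: DE.
Qed.

Lemma submodZ (D : set L) a x : submod D -> D x -> D (a *: x).
Proof. by move=> [D0 DD] Dx; rewrite -[_ *: _]addr0; apply: DD. Qed.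
Lemma submodD (D : set L) x y : submod D -> D x -> D y -> D (x + y).
Proof. by move=> [D0 DD] Dx Dy; rewrite -[x]scale1r; apply: DD. Qed.

End Span.

Section SemiInnerProduct.
Context (R : realType) (H : ipSpace R).
Implicit Types (x y : H).

(** Definiteness and completeness are left out so that Cauchy-Schwarz also applies to the possibly
    degenerate tail form in [density_total]. *)
Record semi_ip : Prop := {
  si_linear : forall x, scalar (ip x);
  si_conj : forall x y, ip y x = (ip x y)^*;
  si_ge0 : forall x, 0 <= ip x x }.

Lemma hilbert_semi : is_hilbert H -> semi_ip.
Proof. by case. Qed.

Hypothesis hH : semi_ip.

Lemma ipr_lin x : linear (fun y => ip x y : R[i]^o).
Proof. exact: si_linear. Qed.

Lemma ipDr x y z : ip x (y + z) = ip x y + ip x z.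
Proof. exact: (linD (ipr_lin x)). Qed.
Lemma ipZr x c y : ip x (c *: y) = c * ip x y.
Proof. exact: (linZ (ipr_lin x)). Qed.
Lemma ipNr x y : ip x (- y) = - ip x y.
Proof. exact: (linN (ipr_lin x)). Qed.
Lemma ip0r x : ip x 0 = 0.
Proof. exact: (lin0 (ipr_lin x)). Qed.
Lemma ipBr x y z : ip x (y - z) = ip x y - ip x z.
Proof. exact: (linB (ipr_lin x)). Qed.
Lemma ip_sumr x n (c : 'I_n -> R[i]) v :
  ip x (\sum_(i < n) c i *: v i) = \sum_(i < n) c i * ip x (v i).
Proof. exact: (lin_sum (ipr_lin x)). Qed.
Lemma ipDl x y z : ip (x + y) z = ip x z + ip y z.
Proof. by rewrite !(si_conj hH z) ipDr rmorphD. Qed.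
Lemma ipZl c x y : ip (c *: x) y = c^* * ip x y.
Proof. by rewrite !(si_conj hH y) ipZr rmorphM. Qed.
Lemma ipNl x y : ip (- x) y = - ip x y.
Proof. by rewrite !(si_conj hH y) ipNr rmorphN. Qed.
Lemma ip0l x : ip 0 x = 0.
Proof. by rewrite (si_conj hH) ip0r rmorph0. Qed.
Lemma ipBl x y z : ip (x - y) z = ip x z - ip y z.
Proof. by rewrite ipDl ipNl. Qed.
Lemma ip_suml n (c : 'I_n -> R[i]) v x :
  ip (\sum_(i < n) c i *: v i) x = \sum_(i < n) (c i)^* * ip (v i) x.
Proof.
rewrite (si_conj hH) ip_sumr rmorph_sum; apply: eq_bigr => i _.
by rewrite rmorphM /= -(si_conj hH).
Qed.

Lemma hnorm_ge0 x : 0 <= hnorm x.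
Proof. exact: sqrtr_ge0. Qed.
Lemma hnorm_sq x : hnorm x ^+ 2 = complex.Re (ip x x).
Proof. by rewrite sqr_sqrtr // Re_ge0 // si_ge0. Qed.
Lemma ip_hnorm x : ip x x = (hnorm x ^+ 2)%:C%C.
Proof. by rewrite hnorm_sq -ge0_real // si_ge0. Qed.
Lemma Re_ipC x y : complex.Re (ip y x) = complex.Re (ip x y).
Proof. by rewrite (si_conj hH x) Re_conj. Qed.
Lemma hnorm0 : hnorm (0 : H) = 0.
Proof. by rewrite /hnorm ip0r sqrtr0. Qed.
Lemma hnormZ c x : hnorm (c *: x) = cabs c * hnorm x.
Proof.
apply/eqP; rewrite -(@eqrXn2 _ 2) ?mulr_ge0 ?hnorm_ge0 ?cabs_ge0 // exprMn.
by rewrite !hnorm_sq ipZr ipZl mulrA [c * _]mulrC mul_conj ReZ.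
Qed.
Lemma hnormN x : hnorm (- x) = hnorm x.
Proof. by rewrite /hnorm ipNl ipNr opprK. Qed.
Lemma hnormBC x y : hnorm (x - y) = hnorm (y - x).
Proof. by rewrite -hnormN opprB. Qed.
Lemma hnormD_sq x y :
  hnorm (x + y) ^+ 2 = hnorm x ^+ 2 + 2 * complex.Re (ip x y) + hnorm y ^+ 2.
Proof. rewrite !hnorm_sq ipDl !ipDr !ReD (Re_ipC x y); ring. Qed.
Lemma hnormB_sq x y :
  hnorm (x - y) ^+ 2 = hnorm x ^+ 2 - 2 * complex.Re (ip x y) + hnorm y ^+ 2.
Proof. by rewrite hnormD_sq hnormN ipNr ReN mulrN. Qed.
Lemma parallelogram x y :
  hnorm (x + y) ^+ 2 + hnorm (x - y) ^+ 2 = 2 * hnorm x ^+ 2 + 2 * hnorm y ^+ 2.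
Proof. rewrite hnormD_sq hnormB_sq; ring. Qed.
(** Bounds a mixed term by a single vector; [normal_state_dense] uses it to replace two sequences by
    their sum. *)
Lemma polar_le x y : 4 * complex.Re (ip x y) <= hnorm (x + y) ^+ 2.
Proof.
rewrite -subr_ge0 (_ : _ - _ = hnorm (x - y) ^+ 2) ?sqr_ge0 //.
rewrite hnormD_sq hnormB_sq; ring.
Qed.

Lemma Re_ip_le x y : complex.Re (ip x y) <= hnorm x * hnorm y.
Proof.
have key t : 0 <= hnorm x ^+ 2 - 2 * t * complex.Re (ip x y) + t ^+ 2 * hnorm y ^+ 2.
  have := sqr_ge0 (hnorm (x - t%:C%C *: y)).
  rewrite hnormB_sq ipZr ReZ hnormZ exprMn cabs_real -normrX ger0_norm ?sqr_ge0 //.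
  by rewrite mulrA.
rewrite leNgt; apply/negP => h.
set c := complex.Re _ in key h *.
have c0 : 0 < c by apply: le_lt_trans h; rewrite mulr_ge0 ?hnorm_ge0.
have nx := hnorm_ge0 x; have ny := hnorm_ge0 y.
(* A vector of norm 0 need not vanish here. Then [key] is affine in [t], and the value inserted
   makes its right side [-1]. Otherwise the minimizing [t] is inserted. *)
have [y0|y0] := eqVneq (hnorm y) 0.
  have := key ((hnorm x ^+ 2 + 1) / (2 * c)); rewrite y0 expr0n mulr0 addr0.
  have -> : 2 * ((hnorm x ^+ 2 + 1) / (2 * c)) * c = hnorm x ^+ 2 + 1.
    by field; rewrite gt_eqF.
  lra.
have := key (c / hnorm y ^+ 2).
have -> : hnorm x ^+ 2 - 2 * (c / hnorm y ^+ 2) * c + (c / hnorm y ^+ 2) ^+ 2 * hnorm y ^+ 2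
  = hnorm x ^+ 2 - c ^+ 2 / hnorm y ^+ 2 by field.
rewrite subr_ge0 ler_pdivrMr ?exprn_gt0 ?lt_def ?y0 // -exprMn.
by rewrite ler_pXn2r ?nnegrE ?mulr_ge0 // ?(ltW c0) // leNgt h.
Qed.

Lemma cauchy_schwarz x y : cabs (ip x y) <= hnorm x * hnorm y.
Proof.
have [u [u1 uz]] := phase (ip x y).
have := Re_ip_le x (u *: y).
by rewrite ipZr uz hnormZ u1 mul1r.
Qed.

Lemma hnormD x y : hnorm (x + y) <= hnorm x + hnorm y.
Proof.
rewrite -(@ler_pXn2r _ 2) ?nnegrE ?addr_ge0 ?hnorm_ge0 // hnormD_sq sqrrD.
by have := Re_ip_le x y; rewrite mulr2n => ?; lra.
Qed.
Lemma hnormB_tri y x z : hnorm (x - z) <= hnorm (x - y) + hnorm (y - z).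
Proof. by have := hnormD (x - y) (y - z); rewrite addrA subrK. Qed.
Lemma hnorm_le_sub x y : hnorm y <= hnorm x + hnorm (x - y).
Proof. by have := hnormD x (y - x); rewrite addrC subrK (hnormBC y). Qed.

End SemiInnerProduct.

(** * Hilbert spaces *)

Lemma inv_nat_lt (R : realType) (e : R) :
  0 < e -> exists N, forall n, (N <= n)%N -> n.+1%:R^-1 < e.
Proof.
move=> e0; have [N hN] := ltr_add_invr e0; rewrite add0r in hN.
exists N => n Nn; apply: le_lt_trans hN.
by rewrite lef_pV2 ?posrE ?ltr0n // ler_nat.
Qed.

(** The first-order condition at a minimum. The test value [- A / (B + 1)] avoids division by a
    vanishing [B]. *)
Lemma quadratic_ge0 (R : realType) (A B : R) : 0 <= B ->
  (forall s : R, 0 <= 2 * s * A + s ^+ 2 * B) -> A = 0.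
Proof.
move=> B0 h; have := h (- A / (B + 1)).
have b1 : 0 < B + 1 by lra.
have -> : 2 * (- A / (B + 1)) * A + (- A / (B + 1)) ^+ 2 * B =
  - (A ^+ 2 * ((B + 2) / (B + 1) ^+ 2)) by field; rewrite gt_eqF.
rewrite oppr_ge0 pmulr_lle0; last by rewrite divr_gt0 ?exprn_gt0 //; lra.
by move=> a0; apply/eqP; rewrite -sqrf_eq0 eq_le a0 sqr_ge0.
Qed.

Section Hilbert.
Context (R : realType).
Implicit Types (G H K : ipSpace R).

Lemma hnorm_eq0 H (x : H) : is_hilbert H -> hnorm x = 0 -> x = 0.
Proof.
by move=> hH x0; apply: (ip_eq0 hH); rewrite (ip_hnorm (hilbert_semi hH)) x0 expr0n.
Qed.

Lemma ip_ext H (x y : H) : is_hilbert H -> (forall v, ip v x = ip v y) -> x = y.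
Proof.
move=> hH h; apply/subr0_eq/(ip_eq0 hH).
by rewrite (ipBr (hilbert_semi hH)) h subrr.
Qed.

Lemma hilbert_lim H (u : nat -> H) (C : R) : is_hilbert H ->
  (forall p q, hnorm (u p - u q) ^+ 2 <= C * (p.+1%:R^-1 + q.+1%:R^-1)) ->
  exists x, forall e : R, 0 < e -> exists N, forall n, (N <= n)%N -> hnorm (u n - x) < e.
Proof.
move=> hH h; apply: (ip_complete hH) => e e0.
have C1 : 0 < 2 * (`|C| + 1) by rewrite mulr_gt0 // ltr_wpDl.
have [N hN] := inv_nat_lt (divr_gt0 (exprn_gt0 2 e0) C1).
exists N => m n Nm Nn.
rewrite -(@ltr_pXn2r _ 2) ?nnegrE ?hnorm_ge0 ?ltW //.
apply: le_lt_trans (h m n) _.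
have hm := hN _ Nm; have hn := hN _ Nn.
apply: (@le_lt_trans _ _ ((`|C| + 1) * (m.+1%:R^-1 + n.+1%:R^-1))).
  by rewrite ler_wpM2r ?addr_ge0 ?invr_ge0 // (le_trans (ler_norm _)) ?lerDl.
rewrite ltr_pdivlMr // in hm; rewrite ltr_pdivlMr // in hn.
by move: hm hn; set a := _^-1; set b := _^-1 => ? ?; nra.
Qed.

(** [k] is the limit of [c] along a minimizing sequence of [F] on [D]. Keeping [c] apart from the
    Hilbert space allows [L] to be an algebra without norm and [c] its GNS class map; with [c] the
    identity, the lemma gives orthogonal projections and the usual Riesz vectors. *)
Lemma riesz G (L : lmodType R[i]) (D : set L) (c : L -> G) (l : L -> R[i]) (M : R) :
  is_hilbert G -> submod D -> linear c -> scalar l -> 0 <= M ->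
  (forall x, D x -> cabs (l x) <= M * hnorm (c x)) ->
  exists k, [/\ forall e : R, 0 < e -> exists x, D x /\ hnorm (k - c x) < e,
    forall x, D x -> ip k (c x) = l x & hnorm k <= M].
Proof.
move=> hG hD hc hl M0 hM; have sG := hilbert_semi hG.
have {}hl : linear (l : L -> R[i]^o) by exact: hl.
pose F x : R := hnorm (c x) ^+ 2 - 2 * complex.Re (l x).
(* Completing the square with [Re (l x) <= M * hnorm (c x)]. *)
have FM x : D x -> - M ^+ 2 <= F x.
  move=> Dx; have := sqr_ge0 (hnorm (c x) - M).
  have := le_trans (le_trans (ler_norm _) (le_Re_cabs (l x))) (hM _ Dx).
  by rewrite sqrrB /F mulr2n; nra.
pose E := [set F x | x in D].
have hE : has_inf E.
  split; first by exists (F 0), 0 => //; exact: hD.1.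
  by exists (- M ^+ 2) => _ [x Dx <-]; exact: FM.
pose m := inf E.
have mF x : D x -> m <= F x by move=> Dx; apply: (ge_inf hE.2); exists x.
have /choice[u hu] : forall n : nat, exists x, D x /\ F x < m + n.+1%:R^-1.
  move=> n; have n0 : (0 : R) < n.+1%:R^-1 by rewrite invr_gt0.
  by have [_ [x Dx <-] ?] := inf_adherent n0 hE; exists x.
have [k hk] : exists k, forall e : R, 0 < e -> exists N, forall n, (N <= n)%N ->
    hnorm (c (u n) - k) < e.
  apply: (@hilbert_lim _ (c \o u) 2 hG) => p q /=.
  have [Dp Fp] := hu p; have [Dq Fq] := hu q.
  (* By the parallelogram law the squared distance is [2 * F (u p) + 2 * F (u q)] minus four times
     [F] at the midpoint, hence at most twice the sum of the two excesses over [m]. *)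
  have Dm : D ((2^-1)%:C%C *: (u p + u q)) by apply: submodZ => //; exact: submodD.
  have := mF _ Dm; rewrite /F (linZ hc) (hnormZ sG) cabs_real exprMn (linZ hl).
  rewrite (linD hc) (linD hl) ReZ ReD ger0_norm ?invr_ge0 //.
  have := parallelogram sG (c (u p)) (c (u q)).
  rewrite /F in Fp Fq; rewrite exprVn => h1 h2.
  have e2 : (2 : R) ^- 2 = 4^-1 by field.
  rewrite e2 in h2; move: Fp Fq h1 h2; set a := _.+1%:R^-1; set b := _.+1%:R^-1.
  by move=> ? ? ? ?; lra.
(* Perturbing [u n] by [s x] near the infimum and passing to the limit gives a nonnegative quadratic
   in [s] whose linear coefficient is the difference of the two sides. *)
have key x : D x -> complex.Re (ip k (c x)) = complex.Re (l x).
  move=> Dx; apply/subr0_eq; apply: (@quadratic_ge0 _ _ (hnorm (c x) ^+ 2)) => [|s].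
    exact: sqr_ge0.
  apply: (@le_eps _ _ _ (1 + 2 * `|s| * hnorm (c x))) => e e0 e1.
  have [N1 h1] := hk _ e0; have [N2 h2] := inv_nat_lt e0.
  pose n := maxn N1 N2.
  have {}h1 := ltW (h1 n (leq_maxl _ _)); have {}h2 := ltW (h2 n (leq_maxr _ _)).
  have [Dn Fn] := hu n.
  have := mF _ (submodD hD (submodZ s%:C%C hD Dx) Dn).
  rewrite /F (linD hc) (linZ hc) (linD hl) (linZ hl) ReD [complex.Re (_ *: _)]ReZ.
  rewrite [_ *: c x + _]addrC (hnormD_sq sG) (hnormZ sG) (ipZr sG) ReZ exprMn cabs_real.
  rewrite -normrX [`|s ^+ 2|]ger0_norm ?sqr_ge0 // => h3; rewrite /F in Fn.
  have h4 : s * complex.Re (ip (c (u n) - k) (c x)) <= `|s| * (e * hnorm (c x)).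
    apply: le_trans (ler_norm _) _; rewrite normrM ler_wpM2l //.
    apply: le_trans (le_Re_cabs _) _; apply: le_trans (cauchy_schwarz sG _ _) _.
    by rewrite ler_wpM2r ?hnorm_ge0.
  rewrite (ipBl sG) ReD ReN in h4; move: h2 Fn; set a := _.+1%:R^-1 => ? ?; nra.
exists k; have kl x : D x -> ip k (c x) = l x.
  move=> Dx; apply: complex_ext; first exact: key.
  have := key ('i%C *: x) (submodZ _ hD Dx).
  rewrite (linZ hc) (linZ hl) (ipZr sG) [complex.Re (_ *: _)]ReM ReM /= !mul0r !mul1r !sub0r.
  by move/oppr_inj.
have kap e : 0 < e -> exists x, D x /\ hnorm (k - c x) < e.
  move=> e0; have [N hN] := hk _ e0; exists (u N); split; first exact: (hu N).1.
  by rewrite (hnormBC sG) hN.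
split=> //.
have [k0|k0] := eqVneq (hnorm k) 0; first by rewrite k0.
have kp : 0 < hnorm k by rewrite lt_def k0 hnorm_ge0.
rewrite -(ler_pM2r kp) -expr2.
apply: (@le_eps _ _ _ (M + hnorm k)) => e e0 _.
have [x [Dx kx]] := kap _ e0.
rewrite (hnorm_sq sG) -{2}(subrK (c x) k) addrC (ipDr sG) ReD.
have h1 := le_trans (ler_norm _) (le_Re_cabs (ip k (c x))).
have h2 := Re_ip_le sG k (k - c x).
have h3 := hM _ Dx; rewrite -(kl _ Dx) in h3.
have h4 : hnorm (c x) <= hnorm k + hnorm (k - c x) := hnorm_le_sub sG k (c x).
have h5 : M * hnorm (c x) <= M * (hnorm k + e) by rewrite ler_wpM2l //; lra.
have h6 : hnorm k * hnorm (k - c x) <= hnorm k * e by rewrite ler_wpM2l // ltW.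
lra.
Qed.

Definition total H (D : set H) := forall v, (forall d, D d -> ip v d = 0) -> v = 0.

Lemma dense_lspan H (D : set H) : dense_span D <->
  forall (x : H) (e : R), 0 < e -> exists y, lspan D y /\ hnorm (x - y) < e.
Proof.
split=> h x e e0.
  by have [n [c [v [vD vx]]]] := h x e e0; exists (\sum_(i < n) c i *: v i); split=> //; exists n, c, v.
by have [_ [[n [c [v [vD ->]]]] vx]] := h x e e0; exists n, c, v.
Qed.

(** The vector [k] is the projection of [x] onto the closed span of [D]; as [x - k] is orthogonal to
    [D], it vanishes. *)
Lemma total_dense H (D : set H) : is_hilbert H -> total D -> dense_span D.
Proof.
move=> hH tD; apply/dense_lspan => x e e0; have sH := hilbert_semi hH.
have [k [k1 k2 _]] : exists k, [/\ forall e : R, 0 < e -> exists y, lspan D y /\ hnorm (k - y) < e,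
    forall y, lspan D y -> ip k y = ip x y & hnorm k <= hnorm x].
  apply: (@riesz H H (lspan D) id (ip x) (hnorm x)) => //.
  - exact: lspan_submod.
  - exact: si_linear.
  - exact: hnorm_ge0.
  - by move=> y _; exact: cauchy_schwarz.
have -> : x = k; last exact: k1.
apply/subr0_eq/tD => d Dd; rewrite (ipBl sH) k2 ?subrr //; exact: sub_lspan.
Qed.

Lemma bounded_opP H K (T : H -> K) : bounded_op T ->
  linear T /\ exists M : R, 0 <= M /\ forall x, hnorm (T x) <= M * hnorm x.
Proof.
move=> [lT [M hM]]; split=> //; exists `|M|; split=> // x.
by apply: le_trans (hM x) _; rewrite ler_wpM2r ?hnorm_ge0 ?ler_norm.
Qed.

Lemma bounded_orth H K (T : H -> K) (D : set H) v x :
  is_hilbert H -> is_hilbert K -> bounded_op T -> dense_span D ->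
  (forall d, D d -> ip v (T d) = 0) -> ip v (T x) = 0.
Proof.
move=> hH hK /bounded_opP[lT [M [M0 hM]]] /dense_lspan dD h.
have sK := hilbert_semi hK.
apply: (@cabs_le0 _ _ (hnorm v * M)) => e e0 _.
have [y [Dy xy]] := dD x e e0.
have Ty : ip v (T y) = 0.
  move: y Dy {xy}; apply: lspan_ind => //; split=> [|a y z /= hy hz].
    by rewrite /= (lin0 lT) (ip0r sK).
  by rewrite lT (ipDr sK) (ipZr sK) hy hz mulr0 addr0.
rewrite -[x](subrK y) (linD lT) (ipDr sK) Ty addr0.
apply: le_trans (cauchy_schwarz sK _ _) _.
rewrite mulrCA ler_wpM2l ?hnorm_ge0 // mulrC.
by apply: le_trans (hM _) _; rewrite ler_wpM2l // ltW.
Qed.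

Lemma bounded_id H : bounded_op (@id H).
Proof. by split=> //; exists 1 => x; rewrite mul1r. Qed.

Lemma dense_total H (D : set H) v : is_hilbert H -> dense_span D ->
  (forall d, D d -> ip v d = 0) -> v = 0.
Proof.
move=> hH dD h; apply: (ip_eq0 hH).
exact: (@bounded_orth H H id D v v hH hH (bounded_id H) dD h).
Qed.

Lemma bounded_comp G H K (T : H -> K) (W : G -> H) :
  bounded_op T -> bounded_op W -> bounded_op (T \o W).
Proof.
move=> /bounded_opP[lT [M [M0 hM]]] /bounded_opP[lW [N [N0 hN]]]; split.
  by move=> a x y /=; rewrite lW lT.
exists (M * N) => x /=; apply: le_trans (hM _) _.
by rewrite -mulrA ler_wpM2l.
Qed.

Lemma bounded_sub H K (T W : H -> K) : is_hilbert K ->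
  bounded_op T -> bounded_op W -> bounded_op (fun x => T x - W x).
Proof.
move=> hK [lT [M hM]] [lW [N hN]]; split.
  by move=> a x y /=; rewrite lT lW scalerBr opprD addrACA.
exists (M + N) => x; rewrite mulrDl.
by apply: le_trans (hnormD (hilbert_semi hK) _ _) _; rewrite lerD // (hnormN (hilbert_semi hK)).
Qed.

Lemma bounded_eq H K (T W : H -> K) (D : set H) :
  is_hilbert H -> is_hilbert K -> bounded_op T -> bounded_op W -> dense_span D ->
  (forall d, D d -> T d = W d) -> T = W.
Proof.
move=> hH hK bT bW dD h; apply/funext => x; apply/subr0_eq/(ip_eq0 hK).
apply: (@bounded_orth H K (fun x => T x - W x) D _ x hH hK (bounded_sub hK bT bW) dD) => d Dd.
by rewrite (h d Dd) subrr (ip0r (hilbert_semi hK)).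
Qed.

Lemma unitary_hnorm H K (T : H -> K) x : unitary_op T -> hnorm (T x) = hnorm x.
Proof. by move=> [_ hT _]; rewrite /hnorm hT. Qed.

Lemma unitary_bounded H K (T : H -> K) : unitary_op T -> bounded_op T.
Proof.
by move=> hT; split; [case: hT | exists 1 => x; rewrite mul1r unitary_hnorm].
Qed.

(* Values are taken in the closed span of [c @` D], described as a double
   orthogonal complement. *)
Lemma adjoint_on G H (L : lmodType R[i]) (D : set L) (c : L -> G) (f : L -> H) (M : R) :
  is_hilbert G -> is_hilbert H -> submod D -> linear c -> linear f -> 0 <= M ->
  (forall x, D x -> hnorm (f x) <= M * hnorm (c x)) ->
  exists J : H -> G, [/\ bounded_op J,
    forall y x, D x -> ip (J y) (c x) = ip y (f x)
    & forall v, (forall x, D x -> ip v (c x) = 0) -> forall y, ip v (J y) = 0].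
Proof.
move=> hG hH hD hc hf M0 hM; have sG := hilbert_semi hG; have sH := hilbert_semi hH.
have /choice[J hJ] : forall y : H, exists k, [/\
    forall v, (forall x, D x -> ip v (c x) = 0) -> ip v k = 0,
    forall x, D x -> ip k (c x) = ip y (f x) & hnorm k <= M * hnorm y].
  move=> y; have [|||k [k1 k2 k3]] := @riesz G L D c (fun x => ip y (f x)) (M * hnorm y) hG hD hc.
  - by move=> a x z /=; rewrite hf (ipDr sH) (ipZr sH).
  - by rewrite mulr_ge0 ?hnorm_ge0.
  - move=> x Dx; apply: le_trans (cauchy_schwarz sH _ _) _.
    by rewrite mulrC -mulrA [hnorm y * _]mulrC mulrA ler_wpM2r ?hnorm_ge0 ?hM.
  exists k; split=> // v hv; apply: (@cabs_le0 _ _ (hnorm v)) => e e0 _.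
  have [x [Dx kx]] := k1 e e0.
  rewrite -[k](subrK (c x)) (ipDr sG) hv // addr0.
  by apply: le_trans (cauchy_schwarz sG _ _) _; rewrite mulrC ler_wpM2r ?hnorm_ge0 ?ltW.
exists J; split=> [|y x Dx|v hv y].
- split; last by exists M => y; case: (hJ y).
  (* The linearity defect [z] is orthogonal to the image of [D], hence to all values of [J]. Being a
     combination of such values, it is orthogonal to itself. *)
  move=> a x y; apply/subr0_eq; set z := _ - _.
  have zJ w : ip z (J w) = 0.
    case: (hJ w) => h _ _; apply: h => u Du.
    rewrite /z (ipBl sG) (ipDl sG) (ipZl sG).
    case: (hJ (a *: x + y)) => _ -> // _; case: (hJ x) => _ -> // _; case: (hJ y) => _ -> // _.
    by rewrite (ipDl sH) (ipZl sH) subrr.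
  apply: (ip_eq0 hG); rewrite {2}/z (ipBr sG) (ipDr sG) (ipZr sG) !zJ.
  by rewrite mulr0 addr0 subrr.
- by case: (hJ y) => _ ->.
- by case: (hJ y) => ->.
Qed.

Section Gram.
Context (H K : ipSpace R) (I : Type) (phi : I -> H) (psi : I -> K).
Hypotheses (hH : is_hilbert H) (hK : is_hilbert K).
Hypothesis gram : forall i j, ip (phi i) (phi j) = ip (psi i) (psi j).

Let sH := hilbert_semi hH.
Let sK := hilbert_semi hK.

Let comb := {n : nat & (('I_n -> R[i]) * ('I_n -> I))%type}.
Let ev (L : ipSpace R) (f : I -> L) (w : comb) : L :=
  \sum_(i < tag w) (tagged w).1 i *: f ((tagged w).2 i).

Let ev_ip w w' : ip (ev phi w) (ev phi w') = ip (ev psi w) (ev psi w').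
Proof.
rewrite /ev (ip_suml sH) (ip_suml sK); apply: eq_bigr => i _; congr (_ * _).
by rewrite (ip_sumr sH) (ip_sumr sK); apply: eq_bigr => j _; rewrite gram.
Qed.

(** The graph of the isometry: one combination must approximate [x] through [phi] and [y] through
    [psi] at once, so no coefficients of [x] have to be singled out. *)
Let rel (x : H) (y : K) := forall e : R, 0 < e ->
  exists w, hnorm (x - ev phi w) < e /\ hnorm (y - ev psi w) < e.

Let ip_close (L : ipSpace R) (x x' s s' : L) (e : R) : semi_ip L -> 0 < e -> e <= 1 ->
  hnorm (x - s) < e -> hnorm (x' - s') < e ->
  cabs (ip x x' - ip s s') <= e * (hnorm x + hnorm x' + 1).
Proof.
move=> sL e0 e1 h h'.
have -> : ip x x' - ip s s' = ip (x - s) x' + ip s (x' - s').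
  by rewrite (ipBl sL) (ipBr sL) addrA subrK.
apply: le_trans (cabsD _ _) _.
have h1 := cauchy_schwarz sL (x - s) x'; have h2 := cauchy_schwarz sL s (x' - s').
have h3 := hnorm_le_sub sL x s.
have n1 := hnorm_ge0 x; have n2 := hnorm_ge0 x'; have n3 := hnorm_ge0 s.
have n4 := hnorm_ge0 (x - s); have n5 := hnorm_ge0 (x' - s').
have h4 : hnorm (x - s) * hnorm x' <= e * hnorm x' by rewrite ler_wpM2r // ltW.
have h5 : hnorm s * hnorm (x' - s') <= (hnorm x + 1) * e by rewrite ler_pM //; lra.
lra.
Qed.

Let rel_ip x y x' y' : rel x y -> rel x' y' -> ip x x' = ip y y'.
Proof.
move=> r r'; apply/subr0_eq.
apply: (@cabs_le0 _ _ ((hnorm x + hnorm x' + 1) + (hnorm y + hnorm y' + 1))) => e e0 e1.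
have [w [w1 w2]] := r e e0; have [w' [w1' w2']] := r' e e0.
have h1 := ip_close sH e0 e1 w1 w1'; have h2 := ip_close sK e0 e1 w2 w2'.
rewrite cabsB in h2; rewrite ev_ip in h1.
rewrite -(subrK (ip (ev psi w) (ev psi w')) (ip x x')) -addrA.
by apply: le_trans (cabsD _ _) _; rewrite mulrDr lerD.
Qed.

Let rel_gen i : rel (phi i) (psi i).
Proof.
move=> e e0; exists (existT _ 1%N (fun=> 1, fun=> i)); rewrite /ev /= !big_ord_recl !big_ord0.
by rewrite !addr0 !scale1r !subrr (hnorm0 sH) (hnorm0 sK).
Qed.

Let rel_total x : dense_span (range phi) -> exists y, rel x y.
Proof.
move=> dphi.
have /choice[w hw] : forall n : nat, exists w, hnorm (x - ev phi w) < n.+1%:R^-1.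
  move=> n; have n0 : (0 : R) < n.+1%:R^-1 by rewrite invr_gt0.
  have [m [c [v [vD vx]]]] := dphi x _ n0.
  have /choice[i hi] : forall k, exists i, phi i = v k.
    by move=> k; have [i _ <-] := vD k; exists i.
  exists (existT _ m (c, i)); rewrite /ev /=.
  by under eq_bigr do rewrite hi.
have [y hy] : exists y, forall e : R, 0 < e -> exists N, forall n, (N <= n)%N ->
    hnorm (ev psi (w n) - y) < e.
  apply: (@hilbert_lim _ (ev psi \o w) 2 hK) => p q /=.
  have -> : hnorm (ev psi (w p) - ev psi (w q)) = hnorm (ev phi (w p) - ev phi (w q)).
    by rewrite /hnorm !(ipBl sK) !(ipBr sK) !(ipBl sH) !(ipBr sH) !ev_ip.
  have := hnormB_tri sH x (ev phi (w p)) (ev phi (w q)).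
  rewrite (hnormBC sH (ev phi (w p)) x).
  have hp := hw p; have hq := hw q.
  have p1 : p.+1%:R^-1 <= (1 : R) by rewrite invf_le1 // ler1n.
  have q1 : q.+1%:R^-1 <= (1 : R) by rewrite invf_le1 // ler1n.
  have := hnorm_ge0 (ev phi (w p) - ev phi (w q)).
  set a := hnorm _ in hp *; set b := hnorm _ in hq *; set d := hnorm _.
  set p' := _^-1 in hp p1 *; set q' := _^-1 in hq q1 *.
  (* Both [d <= p' + q'] and [d <= 2] hold; their product is the rate that [hilbert_lim] asks
     for. *)
  move=> d0 dab; have : d * d <= (p' + q') * 2 by rewrite ler_pM //; lra.
  by rewrite expr2 [2 * _]mulrC.
exists y => e e0; have [N1 h1] := hy e e0; have [N2 h2] := inv_nat_lt e0.
exists (w (maxn N1 N2)); split; first by apply: lt_trans (hw _) (h2 _ (leq_maxr _ _)).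
by rewrite (hnormBC sK) h1 ?leq_maxl.
Qed.

Lemma gram_isometry : dense_span (range phi) ->
  exists T : H -> K, [/\ linear T, forall x y, ip (T x) (T y) = ip x y
    & forall i, T (phi i) = psi i].
Proof.
move=> dphi; have /choice[T hT] := fun x => rel_total x dphi.
have Tip x y : ip (T x) (T y) = ip x y by rewrite (rel_ip (hT x) (hT y)).
have Teq x y : rel x y -> T x = y.
  move=> r; apply/subr0_eq/(ip_eq0 hK); rewrite (ipBl sK) !(ipBr sK).
  rewrite -(rel_ip (hT x) r) -(rel_ip r (hT x)) -(rel_ip r r) -(rel_ip (hT x) (hT x)).
  by rewrite !subrr.
exists T; split=> //; last by move=> i; apply: Teq.
(* The squared norm of the linearity defect expands into inner products, all preserved by [T], and
   the corresponding expression in [H] cancels. *)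
move=> a x y; apply/subr0_eq/(ip_eq0 hK).
rewrite !(ipBl sK, ipBr sK, ipDl sK, ipDr sK, ipZl sK, ipZr sK) !Tip.
by rewrite !(ipDl sH, ipDr sH, ipZl sH, ipZr sH); ring.
Qed.

End Gram.

(** Surjectivity comes from the isometry in the opposite direction: the composite fixes every
    [psi i]. This is the source of [ht_map], [ht_assoc], [gns_V] and the multiplications. *)
Lemma gram_unitary H K (I : Type) (phi : I -> H) (psi : I -> K) :
  is_hilbert H -> is_hilbert K -> dense_span (range phi) -> dense_span (range psi) ->
  (forall i j, ip (phi i) (phi j) = ip (psi i) (psi j)) ->
  exists T : H -> K, unitary_op T /\ forall i, T (phi i) = psi i.
Proof.
move=> hH hK dphi dpsi gram.
have [T [lT iT gT]] := gram_isometry hH hK gram dphi.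
have [W [lW iW gW]] := gram_isometry hK hH (fun i j => esym (gram i j)) dpsi.
exists T; split=> //; split=> // y; exists (W y).
have bT : bounded_op T by split=> //; exists 1 => x; rewrite /hnorm iT mul1r.
have bW : bounded_op W by split=> //; exists 1 => x; rewrite /hnorm iW mul1r.
have := bounded_eq hK hK (bounded_comp bT bW) (bounded_id K) dpsi.
by move=> /(_ _)/(congr1 (@^~ y)); apply => _ [i _ <-] /=; rewrite gW gT.
Qed.

End Hilbert.

(** * Hilbert space tensor products and coherent families *)

Section HilbertTensor.
Context (R : realType) (HT : hilbert_tensor R).
Implicit Types (H K L : ipSpace R).

Lemma hnorm_pure H K (x : H) (y : K) : is_hilbert H -> is_hilbert K ->
  hnorm (ht_pure HT x y) = hnorm x * hnorm y.
Proof.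
move=> hH hK; have hHK := hilbert_semi (ht_hilbert HT hH hK).
apply/eqP; rewrite -(@eqrXn2 _ 2) ?mulr_ge0 ?hnorm_ge0 // exprMn.
rewrite (hnorm_sq hHK) ht_ip // (ip_hnorm (hilbert_semi hH)) ReZ.
by rewrite (ip_hnorm (hilbert_semi hK)).
Qed.

Lemma bounded_purel H K (y : K) : is_hilbert H -> is_hilbert K ->
  bounded_op (fun x : H => ht_pure HT x y).
Proof.
move=> hH hK; split; first exact: ht_linearl.
by exists (hnorm y) => x; rewrite hnorm_pure // mulrC.
Qed.

Lemma bounded_purer H K (x : H) : is_hilbert H -> is_hilbert K ->
  bounded_op (fun y : K => ht_pure HT x y).
Proof.
move=> hH hK; split; first exact: ht_linearr.
by exists (hnorm x) => y; rewrite hnorm_pure.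
Qed.

(** A vector orthogonal to the family is orthogonal to all elementary tensors, by freeing one leg at
    a time. *)
Lemma dense_pure H K (I J : Type) (phi : I -> H) (psi : J -> K) :
  is_hilbert H -> is_hilbert K ->
  dense_span (range phi) -> dense_span (range psi) ->
  dense_span (range (fun ij : I * J => ht_pure HT (phi ij.1) (psi ij.2))).
Proof.
move=> hH hK dphi dpsi; have hHK := ht_hilbert HT hH hK.
apply: total_dense => // v h.
have dD := @ht_dense R HT H K hH hK.
apply: (@dense_total _ _ _ v hHK dD) => _ [x [y ->]].
apply: (@bounded_orth _ _ _ (fun x => ht_pure HT x y) _ v x hH hHK
  (bounded_purel y hH hK) dphi) => _ [i _ <-].
apply: (@bounded_orth _ _ _ (ht_pure HT (phi i)) _ v y hK hHK
  (bounded_purer (phi i) hH hK) dpsi) => _ [j _ <-].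
by apply: h; exists (i, j).
Qed.

Lemma dense_range_surj H K (T : H -> K) :
  is_hilbert K -> (forall y, exists x, T x = y) -> dense_span (range T).
Proof.
move=> hK sT; apply: total_dense => // v h; apply: (ip_eq0 hK).
by have [x xv] := sT v; apply: h; exists x.
Qed.

Lemma bounded_pure_eq H K L (I J : Type) (phi : I -> H) (psi : J -> K)
    (T W : HT H K -> L) : is_hilbert H -> is_hilbert K -> is_hilbert L ->
  dense_span (range phi) -> dense_span (range psi) -> bounded_op T -> bounded_op W ->
  (forall i j, T (ht_pure HT (phi i) (psi j)) = W (ht_pure HT (phi i) (psi j))) ->
  T = W.
Proof.
move=> hH hK hL dphi dpsi bT bW h.
apply: (bounded_eq (ht_hilbert HT hH hK) hL bT bW (dense_pure hH hK dphi dpsi)).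
by move=> _ [[i j] _ <-].
Qed.

Lemma dense_id H : is_hilbert H -> dense_span (range (@id H)).
Proof. by move=> hH; apply: dense_range_surj => // y; exists y. Qed.

(** [ht_map] selects some bounded operator with the prescribed values; density identifies it with
    the unitary supplied by [gram_unitary]. The same reasoning settles [ht_assoc]. *)
Lemma ht_mapP H K H' K' (A : H -> H') (B : K -> K') :
  is_hilbert H -> is_hilbert K -> is_hilbert H' -> is_hilbert K' ->
  unitary_op A -> unitary_op B ->
  unitary_op (@ht_map R HT _ _ _ _ A B) /\
  forall x y, ht_map A B (ht_pure HT x y) = ht_pure HT (A x) (B y).
Proof.
move=> hH hK hH' hK' uA uB.
have dA := dense_range_surj hH' (let: And3 _ _ s := uA in s).
have dB := dense_range_surj hK' (let: And3 _ _ s := uB in s).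
have [||ij kl|T [uT hT]] := gram_unitary (ht_hilbert HT hH hK) (ht_hilbert HT hH' hK')
   (phi := fun p : H * K => ht_pure HT p.1 p.2)
   (psi := fun p : H * K => ht_pure HT (A p.1) (B p.2)).
- exact: dense_pure (dense_id hH) (dense_id hK).
- exact: dense_pure dA dB.
- by rewrite !ht_ip //; case: uA => _ -> _; case: uB => _ -> _.
have [|b r] := @xgetPex _ (fun=> 0) [set T : HT H K -> HT H' K' | bounded_op T /\
    forall x y, T (ht_pure HT x y) = ht_pure HT (A x) (B y)].
  by exists T; split; [exact: unitary_bounded | move=> x y; exact: (hT (x, y))].
split=> //; suff -> : ht_map A B = T by [].
apply: (bounded_pure_eq hH hK _ (dense_id hH) (dense_id hK)) => //.
- exact: ht_hilbert.
- exact: unitary_bounded.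
- by move=> x y; rewrite /ht_map r (hT (x, y)).
Qed.

Lemma ht_assocP H K L : is_hilbert H -> is_hilbert K -> is_hilbert L ->
  unitary_op (@ht_assoc R HT H K L) /\
  forall x y z, ht_assoc (ht_pure HT (ht_pure HT x y) z) =
    ht_pure HT x (ht_pure HT y z) :> HT H (HT K L).
Proof.
move=> hH hK hL; have hHK := ht_hilbert HT hH hK; have hKL := ht_hilbert HT hK hL.
have dHK := dense_pure hH hK (dense_id hH) (dense_id hK).
have dKL := dense_pure hK hL (dense_id hK) (dense_id hL).
have d1 := dense_pure hHK hL dHK (dense_id hL).
have [||ij kl|T [uT hT]] := gram_unitary (ht_hilbert HT hHK hL) (ht_hilbert HT hH hKL)
   (phi := fun p : (H * K) * L => ht_pure HT (ht_pure HT p.1.1 p.1.2) p.2)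
   (psi := fun p : (H * K) * L => ht_pure HT p.1.1 (ht_pure HT p.1.2 p.2)).
- exact: d1.
- apply: total_dense => [|v h]; first exact: ht_hilbert.
  apply: (dense_total (ht_hilbert HT hH hKL) (dense_pure hH hKL (dense_id hH) dKL)).
  by move=> _ [[x [y z]] _ <-]; apply: h; exists (x, y, z).
- by rewrite !ht_ip // mulrA.
have [|b r] := @xgetPex _ (fun=> 0) [set T : HT (HT H K) L -> HT H (HT K L) | bounded_op T /\
    forall x y z, T (ht_pure HT (ht_pure HT x y) z) = ht_pure HT x (ht_pure HT y z)].
  by exists T; split; [exact: unitary_bounded | move=> x y z; exact: (hT (x, y, z))].
split=> //; suff -> : @ht_assoc R HT H K L = T by [].
apply: (bounded_pure_eq hHK hL _ dHK (dense_id hL)) => //.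
- exact: ht_hilbert.
- exact: unitary_bounded.
- by move=> [x y] z; rewrite /ht_assoc r (hT (x, y, z)).
Qed.

End HilbertTensor.

Section ComplexLine.
Context (R : realType).

Lemma hnorm_Cspace (x : Cspace R) : hnorm x = cabs (x : R[i]).
Proof.
by rewrite /hnorm /= mul_conj /= sqrtr_sqr ger0_norm ?cabs_ge0.
Qed.

Lemma cabs_le_ReIm (x : R[i]) : cabs x <= `|complex.Re x| + `|complex.Im x|.
Proof.
rewrite -(@ler_pXn2r _ 2) ?nnegrE ?addr_ge0 ?cabs_ge0 // cabs_sq sqrrD !real_normK ?num_real //.
by have := mulr_ge0 (normr_ge0 (complex.Re x)) (normr_ge0 (complex.Im x)); rewrite mulr2n => ?; lra.
Qed.

Lemma real_complete (u : nat -> R) :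
  (forall e : R, 0 < e -> exists N, forall m n : nat,
     (N <= m)%N -> (N <= n)%N -> `|u m - u n| < e) ->
  exists x : R, forall e : R, 0 < e -> exists N, forall n : nat,
     (N <= n)%N -> `|u n - x| < e.
Proof.
move=> h; have /cauchy_cvg/cvg_ex[x hx] : cauchy (u @ \oo).
  apply/cauchy_exP => e e0; have [N hN] := h e e0.
  by exists (u N); exists N => // n /= Nn; rewrite -ball_normE /=; exact: hN.
exists x => e e0; move/cvgrPdist_lt/(_ e e0) : hx => [N _ hN].
by exists N => n Nn; rewrite distrC; exact: hN.
Qed.

Lemma Cspace_hilbert : is_hilbert (Cspace R).
Proof.
split.
- by move=> x a y z /=; rewrite mulrDr; congr (_ + _); rewrite mulrCA.
- by move=> x y /=; rewrite rmorphM /= conjCK mulrC.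
- by move=> x /=; rewrite mul_conj ler0c sqr_ge0.
- move=> x /=; rewrite mul_conj => -[/eqP]; rewrite sqrf_eq0 => /eqP; exact: cabs_eq0.
- move=> u hu.
  have [a ha] : exists a : R, forall e : R, 0 < e -> exists N, forall n : nat,
     (N <= n)%N -> `|complex.Re (u n) - a| < e.
    apply: real_complete => e e0; have [N hN] := hu e e0; exists N => m n Nm Nn.
    apply: le_lt_trans (hN m n Nm Nn); rewrite hnorm_Cspace -ReN -ReD; exact: le_Re_cabs.
  have [b hb] : exists b : R, forall e : R, 0 < e -> exists N, forall n : nat,
     (N <= n)%N -> `|complex.Im (u n) - b| < e.
    apply: real_complete => e e0; have [N hN] := hu e e0; exists N => m n Nm Nn.
    apply: le_lt_trans (hN m n Nm Nn); rewrite hnorm_Cspace -ImN -ImD; exact: le_Im_cabs.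
  exists (Complex a b) => e e0; have e2 : 0 < e / 2 by rewrite divr_gt0.
  have [N1 h1] := ha _ e2; have [N2 h2] := hb _ e2.
  exists (maxn N1 N2) => n; rewrite geq_max => /andP[/h1 {}h1 /h2 {}h2].
  rewrite hnorm_Cspace; apply: le_lt_trans (cabs_le_ReIm _) _.
  by rewrite ReD ReN ImD ImN /=; lra.
Qed.

Lemma Cspace_separable : is_separable (Cspace R).
Proof.
pose u n : Cspace R := if @unpickle (rat * rat)%type n is Some q
  then Complex (ratr q.1) (ratr q.2) else 0.
exists u => x e e0; have e2 : 0 < e / 2 by rewrite divr_gt0.
have ap (a : R) : exists q : rat, `|a - ratr q| < e / 2.
  have [|q] := @rat_in_itvoo R (a - e / 2) (a + e / 2); first lra.
  rewrite in_itv /= => /andP[h1 h2]; exists q.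
  by rewrite distrC ltr_distl h1 h2.
have [p hp] := ap (complex.Re x); have [q hq] := ap (complex.Im x).
exists (pickle (p, q)); rewrite /u pickleK hnorm_Cspace.
apply: le_lt_trans (cabs_le_ReIm _) _.
by rewrite ReD ReN ImD ImN /=; lra.
Qed.

End ComplexLine.

Section Transport.
Context (R : realType) (E K : ipSpace R) (T : E -> K).
Hypotheses (uT : unitary_op T) (hK : is_hilbert K).

(** Injectivity is asked for separately: deducing it from preservation of inner products would use
    the definiteness of [E], which is being proved. *)
Lemma hilbert_transport : injective T -> is_hilbert E.
Proof.
case: (uT) => lT iT sT jT; have sK := hilbert_semi hK; split.
- by move=> x a y z; rewrite -!iT lT (ipDr sK) (ipZr sK).
- by move=> x y; rewrite -!iT; exact: ip_conj.
- by move=> x; rewrite -iT; exact: ip_ge0.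
- by move=> x; rewrite -iT => /(ip_eq0 hK); rewrite -(lin0 lT) => /jT.
- move=> u hu; have [|y hy] := ip_complete hK (u := T \o u).
    move=> e e0; have [N hN] := hu e e0; exists N => m n Nm Nn /=.
    by rewrite -(linB lT) (unitary_hnorm _ uT) hN.
  have [x xy] := sT y; exists x => e e0; have [N hN] := hy e e0; exists N => n Nn.
  by rewrite -(unitary_hnorm _ uT) (linB lT) xy hN.
Qed.

Lemma separable_transport : is_separable K -> is_separable E.
Proof.
case: (uT) => lT iT sT [u hu]; have /choice[v hv] := fun n => sT (u n).
exists v => x e e0; have [n hn] := hu (T x) e e0; exists n.
by rewrite -(unitary_hnorm _ uT) (linB lT) hv.
Qed.

End Transport.

Section CoherentSpace.
Context (R : realType) (I : Type) (H : I -> ipSpace R)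
  (U : forall i j, {linear H i -> H j}).
Hypotheses (U_unitary : forall i j, unitary_op (U i j))
  (U_id : forall i x, U i i x = x)
  (U_comp : forall i j k x, U j k (U i j x) = U i k x).

(** The description defining the inner product has a solution because the [U i j] preserve inner
    products. *)
Lemma coh_ip (x y : coh_space U) i : ip x y = ip (coh_fun x i) (coh_fun y i).
Proof.
apply: (@xgetPex _ 0 [set z : R[i] | forall i, z = ip (coh_fun x i) (coh_fun y i)]).
exists (ip (coh_fun x i) (coh_fun y i)) => j.
by rewrite (cohP x i j) (cohP y i j); case: (U_unitary i j) => _ ->.
Qed.

Lemma coh_inj (x y : coh_space U) i : coh_fun x i = coh_fun y i -> x = y.
Proof. by move=> h; apply: coh_ext => j; rewrite (cohP x i j) (cohP y i j) h. Qed.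

Lemma coh_surj i (v : H i) : exists x : coh_space U, coh_fun x i = v.
Proof.
have h j k : U i k v = U j k (U i j v) by rewrite U_comp.
by exists (Coherent h); exact: U_id.
Qed.

Lemma coh_unitary i : unitary_op (fun x : coh_space U => coh_fun x i).
Proof. by split=> [a x y|x y|y] //; [rewrite (coh_ip x y i) | exact: coh_surj]. Qed.

End CoherentSpace.

(** * The bicommutant density argument *)

Section Representations.
Context (R : realType) (A : starAlg R) (H : ipSpace R) (p : A -> H -> H).
Hypothesis hp : is_rep p.

Lemma rep_linear_op a : linear (p a).
Proof. by case: (rep_bounded hp a). Qed.
Lemma rep_adj a x y : ip (p a x) y = ip x (p (star a) y).
Proof. by rewrite -(rep_star hp) starK. Qed.
Lemma rep_linear_arg x : linear (p^~ x).
Proof. by move=> c a b; exact: (rep_linear hp). Qed.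

End Representations.

Section Density.
Context (R : realType) (A : starAlg R) (H G : ipSpace R) (p : A -> H -> H)
  (pi : A -> G -> G) (cl : A -> G) (A0 : set A) (xi : nat -> H) (W : R).
Hypotheses (hH : is_hilbert H) (hG : is_hilbert G) (hp : is_rep p) (hpi : is_rep pi)
  (cl_lin : linear cl) (cl_act : forall a b, pi a (cl b) = cl (a * b))
  (cl_dense : dense_span (range cl))
  (A0_1 : A0 1) (A0_mul : forall a b, A0 a -> A0 b -> A0 (a * b))
  (A0_star : forall a, A0 a -> A0 (star a))
  (A0_gen : range p `<=` commutant (commutant (p @` A0)))
  (W0 : 0 < W)
  (norm_le : forall t N, \sum_(n < N) hnorm (p t (xi n)) ^+ 2 <= W * hnorm (cl t) ^+ 2)
  (norm_lim : forall t (e : R), 0 < e ->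
     exists N, W * hnorm (cl t) ^+ 2 - \sum_(n < N) hnorm (p t (xi n)) ^+ 2 < e).

Let sH := hilbert_semi hH.
Let sG := hilbert_semi hG.

(** [norm_le] and [norm_lim] together say that the [hnorm (p t (xi n)) ^+ 2] sum to
    [W * hnorm (cl t) ^+ 2], where [W] undoes the normalization of the state. A single summand
    already makes [cl t |-> p t (xi n)] well defined and bounded. *)
Let norm_le1 n t : hnorm (p t (xi n)) <= Num.sqrt W * hnorm (cl t).
Proof.
rewrite -(@ler_pXn2r _ 2) ?nnegrE ?mulr_ge0 ?sqrtr_ge0 ?hnorm_ge0 // exprMn (@sqr_sqrtr _ W) ?(ltW W0) //.
apply: le_trans (norm_le t n.+1).
by rewrite big_ord_recr /= lerDr sumr_ge0 // => i _; exact: sqr_ge0.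
Qed.

(** [V] is built as the adjoint of [Vs], which replaces an extension by continuity. [Vs] and [J]
    come from the same map, tested on all classes or only on those of the span of [A0]. *)
Let adjoints n : exists VVJ : (G -> H) * (H -> G) * (H -> G), let: (V, Vs, J) := VVJ in
  [/\ [/\ bounded_op V, bounded_op J & forall g x, ip (V g) x = ip g (Vs x)],
      forall x t, ip (Vs x) (cl t) = ip x (p t (xi n)),
      forall x t, lspan A0 t -> ip (J x) (cl t) = ip x (p t (xi n))
    & forall v, (forall t, lspan A0 t -> ip v (cl t) = 0) -> forall y, ip v (J y) = 0].
Proof.
have plin : linear (fun t => p t (xi n)) by exact: rep_linear_arg.
have [Vs [bVs hVs _]] := @adjoint_on R G H A setT cl (fun t => p t (xi n)) (Num.sqrt W) hG hH
  (conj I (fun _ _ _ _ _ => I)) cl_lin plin (sqrtr_ge0 _) (fun t _ => norm_le1 n t).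
have [J [bJ hJ oJ]] := @adjoint_on R G H A (lspan A0) cl (fun t => p t (xi n)) (Num.sqrt W) hG hH
  (lspan_submod A0) cl_lin plin (sqrtr_ge0 _) (fun t _ => norm_le1 n t).
have [lVs [M [M0 hM]]] := bounded_opP bVs.
have [V [bV hV _]] := @adjoint_on R H G H setT id Vs M hH hG
  (conj I (fun _ _ _ _ _ => I)) (fun _ _ _ => erefl) lVs M0 (fun t _ => hM t).
exists (V, Vs, J); split=> //; first by split=> // g x; exact: hV.
by move=> x t; exact: hVs.
Qed.

(* In the proof, [V n] extends [cl t |-> p t (xi n)], [Vs n] is its adjoint, and
   [J n] is the adjoint of its restriction to the closed span of [cl @` A0]. *)
Lemma density_total v : (forall a, A0 a -> ip v (cl a) = 0) -> v = 0.
Proof.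
have /choice[F hF] := adjoints.
pose V n := (F n).1.1; pose Vs n := (F n).1.2; pose J n := (F n).2.
have {}hF n : [/\ [/\ bounded_op (V n), bounded_op (J n)
        & forall g x, ip (V n g) x = ip g (Vs n x)],
      forall x t, ip (Vs n x) (cl t) = ip x (p t (xi n)),
      forall x t, lspan A0 t -> ip (J n x) (cl t) = ip x (p t (xi n))
    & forall v, (forall t, lspan A0 t -> ip v (cl t) = 0) -> forall y, ip v (J n y) = 0].
  by have := hF n; rewrite /V /Vs /J; case: (F n) => [[]].
have bV n : bounded_op (V n) by case: (hF n) => [[]].
have bJ n : bounded_op (J n) by case: (hF n) => [[]].
have VE n g x : ip (V n g) x = ip g (Vs n x) by case: (hF n) => [[]].
have VsE n x t : ip (Vs n x) (cl t) = ip x (p t (xi n)) by case: (hF n).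
have JE n x t : lspan A0 t -> ip (J n x) (cl t) = ip x (p t (xi n)) by case: (hF n) => _ _ h _; exact: h.
have Jperp n u : (forall t, lspan A0 t -> ip u (cl t) = 0) -> forall y, ip u (J n y) = 0.
  by case: (hF n) => _ _ _; apply.
have Vcl n t : V n (cl t) = p t (xi n).
  apply: (ip_ext hH) => x; rewrite (si_conj sH) VE -(si_conj sG) VsE.
  by [].
have Vpi n t g : V n (pi t g) = p t (V n g).
  have bp : bounded_op (p t) := rep_bounded hp t.
  have bpi : bounded_op (pi t) := rep_bounded hpi t.
  have := bounded_eq hG hH (bounded_comp (bV n) bpi) (bounded_comp bp (bV n)) cl_dense.
  move=> /(_ _)/(congr1 (@^~ g)); apply => _ [s _ <-] /=.
  by rewrite cl_act !Vcl (rep_mul hp).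
have D1 : lspan A0 1 by exact: sub_lspan.
have DM a : A0 a -> forall b, lspan A0 b -> lspan A0 (a * b).
  move=> Aa; apply: lspan_ind => [|b Ab]; last exact: sub_lspan (A0_mul Aa Ab).
  have [l0 lD] := lspan_submod A0; split=> [|c x y] /=; first by rewrite mulr0.
  by move=> hx hy; rewrite mulrDr -scalerAr; apply: lD.
(* The defect [z] is orthogonal to the classes of the span of [A0], since [star a] is in [A0]. By
   stability under products so is [pi (star a) z]; thus both halves of [ip z z] vanish by
   [Jperp]. *)
have Jpi n a x : A0 a -> J n (p a x) = pi a (J n x).
  move=> Aa; apply/subr0_eq; set z := _ - _.
  have zperp t : lspan A0 t -> ip z (cl t) = 0.
    move=> Dt; rewrite (ipBl sG) (rep_adj hpi) cl_act !JE //; last by apply: DM => //; exact: A0_star.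
    by rewrite (rep_mul hp) (rep_adj hp) subrr.
  apply: (ip_eq0 hG); rewrite {2}/z (ipBr sG) Jperp // -(rep_star hpi) Jperp ?subrr //.
  move=> t Dt; rewrite (rep_star hpi) cl_act zperp //; exact: DM.
(* Only partial sums of the norm identity are available. With [N] fixed by [s] and [cl t] close to
   [g], the number [W * ip g (cl s)] is two approximation errors plus the tail of the sum at
   [(t, s)]; the first [N] terms are a pairing with [y], to which [g] is orthogonal. *)
have Vinj g : (forall n, V n g = 0) -> g = 0.
  move=> Vg; apply: (dense_total hG cl_dense) => _ [s _ <-].
  apply: (@mulfI _ W%:C%C); first by apply/eqP => -[/eqP]; rewrite gt_eqF.
  rewrite mulr0; apply: (@cabs_le0 _ _ (W * hnorm (cl s) + 1 + Num.sqrt W * (hnorm g + 1))).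
  move=> e e0 e1; have [N hN] := norm_lim s (exprn_gt0 2 e0).
  pose y := \sum_(n < N) 1 *: Vs n (p s (xi n)).
  have y1 : 0 < 1 + hnorm y by rewrite ltr_wpDr ?hnorm_ge0.
  have cl_sub : submod (range cl).
    split=> [|c _ _ [a _ <-] [b _ <-]]; first by exists 0 => //; exact: lin0.
    by exists (c *: a + b) => //; rewrite cl_lin.
  (* [y] is fixed before [t], so the accuracy may be divided by [1 + hnorm y]. *)
  have [_ [/(lspan_ind cl_sub (fun _ => id)) [t _ <-]]] :=
    (proj1 (dense_lspan _) cl_dense) g (e / (1 + hnorm y)) (divr_gt0 e0 y1).
  rewrite ltr_pdivlMr // => gt.
  (* The tail form after [N] terms: positive by [norm_le], small at [s] by the choice of [N], and at
     most [W * hnorm (cl t) ^+ 2] at [t]. Cauchy-Schwarz for it bounds the mixed tail. *)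
  pose B := @IpSpace R (A : lmodType R[i]) (fun a b => W%:C%C * ip (cl a) (cl b) -
    \sum_(n < N) ip (p a (xi n)) (p b (xi n))).
  have BE (a : B) : ip a a =
      (W * hnorm (cl a) ^+ 2 - \sum_(n < N) hnorm (p a (xi n)) ^+ 2)%:C%C.
    rewrite /= (ip_hnorm sG) -rmorphM rmorphB rmorph_sum; congr (_ - _).
    by apply: eq_bigr => i _; rewrite (ip_hnorm sH).
  have sB : semi_ip B.
    split.
    - move=> a c b b' /=; rewrite cl_lin (ipDr sG) (ipZr sG).
      under eq_bigr do rewrite (rep_linear hp) (ipDr sH) (ipZr sH).
      by rewrite big_split -mulr_sumr /=; ring.
    - move=> a b /=; rewrite rmorphB rmorph_sum; congr (_ - _).
        rewrite rmorphM (si_conj sG (cl a)); congr (_ * _); exact/esym/conj_real.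
      by apply: eq_bigr => i _; exact: (si_conj sH).
    - by move=> a; rewrite BE ler0c subr_ge0.
  have Bs : hnorm (s : B) <= e.
    rewrite -(@ler_pXn2r _ 2) ?nnegrE ?hnorm_ge0 ?(ltW e0) // (hnorm_sq sB) BE /=.
    exact: ltW.
  have Bt : hnorm (t : B) <= Num.sqrt W * hnorm (cl t).
    rewrite -(@ler_pXn2r _ 2) ?nnegrE ?mulr_ge0 ?sqrtr_ge0 ?hnorm_ge0 //.
    rewrite (hnorm_sq sB) BE /= exprMn (@sqr_sqrtr _ W) ?(ltW W0) //.
    by rewrite lerBlDr lerDl sumr_ge0 // => i _; exact: sqr_ge0.
  have Bts := cauchy_schwarz sB t s.
  have gy : ip g y = 0.
    rewrite (ip_sumr sG); apply: big1 => i _.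
    by rewrite -VE Vg (ip0l sH) mulr0.
  have ty : ip (cl t) y = \sum_(n < N) ip (p t (xi n)) (p s (xi n)).
    rewrite (ip_sumr sG); apply: eq_bigr => i _.
    by rewrite mul1r -VE Vcl.
  have -> : W%:C%C * ip g (cl s) = W%:C%C * ip (g - cl t) (cl s) +
      (ip (cl t - g) y + ip (t : B) (s : B)).
    rewrite (ipBl sG (cl t)) gy ty !(ipBl sG) /=; ring.
  apply: le_trans (cabsD _ _) _; apply: le_trans (lerD (lexx _) (cabsD _ _)) _.
  rewrite cabsM cabs_real ger0_norm ?(ltW W0) //.
  have c1 := cauchy_schwarz sG (g - cl t) (cl s).
  have c2 := cauchy_schwarz sG (cl t - g) y.
  have c3 := hnorm_le_sub sG g (cl t).
  rewrite (hnormBC sG) in c2.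
  have n1 := hnorm_ge0 y; have n2 := hnorm_ge0 (cl s); have n3 := hnorm_ge0 (g - cl t).
  have n4 := hnorm_ge0 (cl t); have n5 := hnorm_ge0 (s : B); have n6 := hnorm_ge0 (t : B).
  have n7 := sqrtr_ge0 W; have n8 := hnorm_ge0 g.
  move: gt c1 c2 c3 Bts Bs Bt n1 n2 n3 n4 n5 n6 n7 n8.
  set d := hnorm (g - cl t); set a1 := cabs _; set a2 := cabs (ip _ y); set a3 := cabs _.
  set S := hnorm (cl s); set Y := hnorm y; set T := hnorm (cl t); set Gg := hnorm g.
  set bs := hnorm _; set bt := hnorm _; set q := Num.sqrt W.
  move=> gt c1 c2 c3 Bts Bs Bt n1 n2 n3 n4 n5 n6 n7 n8.
  have de : d <= e by apply: le_trans (ltW gt); rewrite mulrDr mulr1 lerDl mulr_ge0.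
  have l1 : W * a1 <= W * (e * S).
    by rewrite ler_wpM2l ?(ltW W0) // (le_trans c1) // ler_wpM2r.
  have l2 : a2 <= e by rewrite (le_trans c2) // (le_trans _ (ltW gt)) // ler_wpM2l // lerDr.
  have l3 : a3 <= (q * (Gg + 1)) * e.
    apply: le_trans Bts _; rewrite ler_pM // (le_trans Bt) // ler_wpM2l //; lra.
  lra.
move=> vperp.
have {}vperp t : lspan A0 t -> ip v (cl t) = 0.
  move: t; apply: lspan_ind => //; split=> [|c x y] /=; first by rewrite (lin0 cl_lin) (ip0r sG).
  by move=> hx hy; rewrite cl_lin (ipDr sG) (ipZr sG) hx hy mulr0 addr0.
have Jpit n t x : J n (p t x) = pi t (J n x).
  apply/subr0_eq/Vinj => m; rewrite (linB (bV m).1) Vpi; apply/eqP; rewrite subr_eq0; apply/eqP.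
  have /A0_gen[_ hpt] : range p (p t) by exists t.
  have /hpt/(congr1 (@^~ x)) /= -> // : commutant (p @` A0) (V m \o J n).
  split; first exact: bounded_comp.
  by move=> _ [a Aa <-]; apply/funext => u /=; rewrite Jpi // Vpi.
(* Writing [cl t] as [pi t (cl 1)] turns the claim into [ip u (cl 1) = 0] with [u = pi (star t) v].
   As [1] is in [A0], [u] may be replaced by its projection [k] onto the closed span of the classes
   of [A0]. Then [ip k (Vs n x) = ip k (J n x) = ip u (J n x) = ip v (J n (p t x)) = 0], and [Vinj]
   gives [k = 0]. *)
apply: (dense_total hG cl_dense) => _ [t _ <-].
rewrite -[t]mulr1 -cl_act -(rep_star hpi).
set u := pi _ v.
have lu : scalar (fun x => ip u (cl x)).
  by move=> c x y /=; rewrite cl_lin (ipDr sG) (ipZr sG).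
have [k [k1 k2 _]] := riesz hG (lspan_submod A0) cl_lin lu (hnorm_ge0 u)
  (fun x _ => cauchy_schwarz sG u (cl x)).
have kD w : (forall d, lspan A0 d -> ip w (cl d) = 0) -> ip w k = 0.
  move=> hw; apply: (@cabs_le0 _ _ (hnorm w)) => e e0 _.
  have [d [Dd kd]] := k1 e e0; rewrite -[k](subrK (cl d)) (ipDr sG) hw // addr0.
  by apply: le_trans (cauchy_schwarz sG _ _) _; rewrite mulrC ler_wpM2r ?hnorm_ge0 ?ltW.
suff k0 : k = 0 by rewrite -k2 // k0 (ip0l sG).
apply: Vinj => n; apply: (ip_ext hH) => x; rewrite (ip0r sH) (si_conj sH) VE.
have -> : ip k (Vs n x) = ip k (J n x).
  apply/subr0_eq; rewrite -(ipBr sG) (si_conj sG) kD ?rmorph0 // => d Dd.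
  by rewrite (ipBl sG) VsE JE // subrr.
have -> : ip k (J n x) = ip u (J n x).
  apply/subr0_eq; rewrite -(ipBl sG); apply: Jperp => d Dd.
  by rewrite (ipBl sG) k2 // subrr.
by rewrite /u (rep_star hpi) -Jpit Jperp ?rmorph0.
Qed.

End Density.

(** * Normal functionals *)

Section ComplexSums.
Context (R : realType).
Implicit Types (u v : nat -> R[i]) (a b : nat -> R) (z w : R[i]).

Definition csum u z := forall e : R, 0 < e ->
  exists N, forall n, (N <= n)%N -> cabs (\sum_(i < n) u i - z) < e.

Lemma Re_sum n (u : 'I_n -> R[i]) : complex.Re (\sum_(i < n) u i) = \sum_(i < n) complex.Re (u i).
Proof. by apply: (big_morph (@complex.Re R)) => // x y; exact: ReD. Qed.

Lemma csum_cvg u z :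
  csum u z <-> series (u : nat -> R[i]^o) @ \oo --> (z : R[i]^o).
Proof.
split=> [h|/cvgrPdist_lt h].
  (* A positive element of [R[i]] is real, so its real part serves as tolerance. *)
  apply/cvgrPdist_lt => e; rewrite ltcE /= => /andP[/eqP e1 e2].
  have [N hN] := h _ e2; exists N => // n /= Nn.
  have -> : e = (complex.Re e)%:C%C by exact: complex_ext.
  rewrite seriesEord distrC norm_cabs ltcR; exact: hN.
move=> e e0; have [|N _ hN] := h e%:C%C; first by rewrite ltcR.
exists N => n Nn; have := hN n Nn.
by rewrite seriesEord distrC norm_cabs ltcR.
Qed.

Lemma csum_unique u z w : csum u z -> csum u w -> z = w.
Proof.
move=> hz hw; apply/subr0_eq; apply: (@cabs_le0 _ _ 2) => e e0 _.
have [N1 h1] := hz e e0; have [N2 h2] := hw e e0.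
have {}h1 := h1 _ (leq_maxl N1 N2); have {}h2 := h2 _ (leq_maxr N1 N2).
rewrite -(subrK (\sum_(i < maxn N1 N2) u i) z) -addrA.
apply: le_trans (cabsD _ _) _; rewrite cabsB in h1; lra.
Qed.

Lemma csum_lin c u v z w :
  csum u z -> csum v w -> csum (fun n => c * u n + v n) (c * z + w).
Proof.
move=> hz hw e e0.
have c0 : 0 < cabs c + 1 by rewrite ltr_wpDl ?cabs_ge0.
have e1 : 0 < e / 2 / (cabs c + 1) by rewrite !divr_gt0.
have e2 : 0 < e / 2 by rewrite divr_gt0.
have [N1 h1] := hz _ e1; have [N2 h2] := hw _ e2.
exists (maxn N1 N2) => n; rewrite geq_max => /andP[/h1 {}h1 /h2 {}h2].
rewrite big_split -mulr_sumr /= opprD addrACA -mulrBr.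
apply: le_lt_trans (cabsD _ _) _; rewrite cabsM.
rewrite ltr_pdivlMr // in h1.
have := cabs_ge0 (\sum_(i < n) u i - z); nra.
Qed.

Lemma csum_finite u m : (forall n, (m <= n)%N -> u n = 0) -> csum u (\sum_(i < m) u i).
Proof.
move=> h e e0; exists m => n mn; rewrite -(subnKC mn) big_split_ord /= addrAC subrr add0r.
by rewrite big1 ?cabs0 // => i _; rewrite h // leq_addr.
Qed.

Lemma sum_mono_lim a C : (forall n, 0 <= a n) -> (forall N, \sum_(i < N) a i <= C) ->
  exists l, (forall N, \sum_(i < N) a i <= l) /\
    forall e : R, 0 < e -> exists N, l - e < \sum_(i < N) a i.
Proof.
move=> a0 aC; pose E := range (fun N => \sum_(i < N) a i).
have hE : has_sup E.
  split; first by exists (\sum_(i < 0) a i), 0%N.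
  by exists C => _ [N _ <-].
exists (sup E); split=> [N|e e0]; first by apply: (ub_le_sup hE.2); exists N.
by have [_ [N _ <-] ?] := sup_adherent e0 hE; exists N.
Qed.

Lemma sum_monotone a m n : (forall n, 0 <= a n) -> (m <= n)%N ->
  \sum_(i < m) a i <= \sum_(i < n) a i.
Proof.
move=> a0 mn; rewrite -(subnKC mn) big_split_ord /= lerDl.
by apply: sumr_ge0.
Qed.

Lemma cabs_sum_le n (u : 'I_n -> R[i]) : cabs (\sum_(i < n) u i) <= \sum_(i < n) cabs (u i).
Proof.
elim/big_ind2: _ => [|x1 x2 y1 y2 h1 h2|i _] //; first by rewrite cabs0.
by apply: le_trans (cabsD _ _) _; exact: lerD.
Qed.

(** Tails are controlled by the distance of the real partial sums from their supremum. *)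
Lemma csum_dominated u a C : (forall n, cabs (u n) <= a n) ->
  (forall N, \sum_(i < N) a i <= C) -> exists z, csum u z.
Proof.
move=> ua aC; have a0 n : 0 <= a n by apply: le_trans (ua n); exact: cabs_ge0.
have [l [l1 l2]] := sum_mono_lim a0 aC.
have key N m : (N <= m)%N ->
    cabs (\sum_(i < m) u i - \sum_(i < N) u i) <= l - \sum_(i < N) a i.
  move=> Nm; rewrite lerBrDl; apply: le_trans _ (l1 m).
  rewrite -(subnKC Nm) !big_split_ord /= [\sum_(i < N) u _ + _]addrC addrK lerD2l.
  by apply: le_trans (cabs_sum_le _) _; apply: ler_sum => i _; exact: ua.
have [|z hz] := ip_complete (Cspace_hilbert R) (u := fun n => \sum_(i < n) u i).
  move=> e e0; have e2 : 0 < e / 2 by rewrite divr_gt0.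
  have [N hN] := l2 _ e2; exists N => m n Nm Nn; rewrite hnorm_Cspace.
  have hm := key _ _ Nm; have hn := key _ _ Nn; rewrite cabsB in hn.
  rewrite -(subrK (\sum_(i < N) u i) (\sum_(i < m) u i)) -addrA.
  apply: le_lt_trans (cabsD _ _) _; lra.
exists z => e e0; have [N hN] := hz e e0; exists N => n Nn.
by have := hN n Nn; rewrite hnorm_Cspace.
Qed.

Lemma csum_real a z : (forall n, 0 <= a n) -> csum (fun n => (a n)%:C%C) z ->
  [/\ 0 <= z, forall N, \sum_(i < N) a i <= complex.Re z &
    forall e : R, 0 < e -> exists N, complex.Re z - \sum_(i < N) a i < e].
Proof.
move=> a0 h.
have sE n : \sum_(i < n) (a i)%:C%C = (\sum_(i < n) a i)%:C%C :> R[i].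
  by rewrite rmorph_sum.
have hRe e : 0 < e -> exists N, forall n, (N <= n)%N ->
    `|\sum_(i < n) a i - complex.Re z| < e.
  move=> e0; have [N hN] := h e e0; exists N => n Nn.
  apply: le_lt_trans (hN n Nn); have := le_Re_cabs (\sum_(i < n) (a i)%:C%C - z).
  by rewrite ReD ReN sE.
have le N : \sum_(i < N) a i <= complex.Re z.
  apply: (@le_eps _ _ _ 1) => e e0 _; have [M hM] := hRe e e0.
  apply: le_trans (sum_monotone a0 (leq_maxl N M)) _.
  have := hM _ (leq_maxr N M); rewrite ltr_distl mulr1 => /andP[_ /ltW]; lra.
split=> // [|e e0].
  rewrite lecE (le_trans _ (le 0%N)) ?big_ord0 // andbT.
  apply/eqP/eqP; rewrite -normr_eq0 eq_le normr_ge0 andbT.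
  apply: (@le_eps _ _ _ 1) => e e0 _; have [N hN] := h e e0.
  have := le_Im_cabs (\sum_(i < N) (a i)%:C%C - z).
  rewrite ImD ImN sE /= add0r normrN; have := hN N (leqnn N); rewrite sE add0r mulr1.
  by move=> h1 h2; apply: ltW; exact: le_lt_trans h2 h1.
have [N hN] := hRe e e0; exists N; have := hN N (leqnn N).
by rewrite distrC => /(le_lt_trans (ler_norm _)).
Qed.

Lemma csum_le u z (b : R) : csum u z -> (forall N, \sum_(i < N) cabs (u i) <= b) -> cabs z <= b.
Proof.
move=> hz hb; apply: (@le_eps _ _ _ 1) => e e0 _; have [N hN] := hz e e0.
have := hN N (leqnn N); rewrite cabsB => h1.
rewrite -[z](subrK (\sum_(i < N) u i)) mulr1 addrC.
apply: le_trans (cabsD _ _) _; apply: lerD; last exact: ltW.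
exact: le_trans (cabs_sum_le _) (hb N).
Qed.

Lemma csum_Re_le u z (b : R) : csum u z ->
  (forall N, complex.Re (\sum_(i < N) u i) <= b) -> complex.Re z <= b.
Proof.
move=> hz hb; apply: (@le_eps _ _ _ 1) => e e0 _; have [N hN] := hz e e0.
have := hN N (leqnn N); have := hb N; have := le_Re_cabs (\sum_(i < N) u i - z).
rewrite ReD ReN ler_norml => /andP[h _]; lra.
Qed.

Lemma square_summableP (H : ipSpace R) (x : nat -> H) : square_summable x <->
  exists C : R, forall N, \sum_(i < N) hnorm (x i) ^+ 2 <= C.
Proof.
have mono : {homo series (fun n => hnorm (x n) ^+ 2) : n m / (n <= m)%N >-> n <= m}.
  move=> m n mn; rewrite !seriesEord.
  by apply: (@sum_monotone (fun n => hnorm (x n) ^+ 2)) => // k; exact: sqr_ge0.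
split=> [h|[C hC]].
  exists (limn (series (fun n => hnorm (x n) ^+ 2))) => N.
  by have := nondecreasing_cvgn_le mono h N; rewrite seriesEord.
apply: nondecreasing_is_cvgn => //.
by exists C => _ [N _ <-]; rewrite seriesEord; exact: hC.
Qed.

End ComplexSums.

Section NormalFunctionals.
Context (R : realType) (GNS : gns_choice R) (A : wstar R) (H : ipSpace R) (p : A -> H -> H).
Hypothesis rz : is_realization (@w_normal R A) p.

Let hH := rz_hilbert rz.
Let hp := rz_rep rz.
Let sH := hilbert_semi hH.

Lemma normalP (f : A -> R[i]) : w_normal f <-> exists xi zeta : nat -> H,
  [/\ square_summable xi, square_summable zeta
    & forall a, csum (fun n => ip (xi n) (p a (zeta n))) (f a)].
Proof.
rewrite (rz_normal rz); split=> -[xi [zeta [h1 h2 h3]]]; exists xi, zeta; split=> // a.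
- by apply/csum_cvg; exact: h3.
- by apply/csum_cvg; exact: h3.
Qed.

(** Each term of the series is linear in the algebra element, and sums are unique. *)
Lemma normal_scalar (f : A -> R[i]) : w_normal f -> scalar f.
Proof.
move=> /normalP[xi [zeta [_ _ h]]] c a b; apply: csum_unique (h _) _.
have := csum_lin c (h a) (h b).
by under eq_fun do rewrite -(ipZr sH) -(ipDr sH) -(rep_linear hp).
Qed.

(** Vector functionals are the ones to which [realized_gen] applies a determining set. *)
Lemma normal_rank1 (x y : H) : w_normal (fun a : A => ip x (p a y)).
Proof.
apply/normalP; exists (fun n => if n is 0%N then x else 0), (fun n => if n is 0%N then y else 0).
have ss (z : H) : square_summable (fun n => if n is 0%N then z else 0).
  apply/square_summableP; exists (hnorm z ^+ 2) => -[|N].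
    by rewrite big_ord0 sqr_ge0.
  by rewrite big_ord_recl /= big1 ?addr0 // => i _; rewrite (hnorm0 sH) expr0n.
split=> // a; have := @csum_finite R
  (fun n => ip (if n is 0%N then x else 0) (p a (if n is 0%N then y else 0))) 1.
rewrite big_ord_recl big_ord0 addr0; apply => -[|n] // _; exact: (ip0l sH).
Qed.

(* [omega] is the normal state [t |-> W^-1 \sum_n <xi n, p t (xi n)>]. *)
Lemma vector_state (xi : nat -> H) : square_summable xi -> (exists n, xi n != 0) ->
  exists (omega : A -> R[i]) (W : R), [/\ is_state omega, 0 < W,
    forall t N, \sum_(n < N) hnorm (p t (xi n)) ^+ 2 <= W * complex.Re (omega (star t * t)) &
    forall t (e : R), 0 < e -> exists N,
      W * complex.Re (omega (star t * t)) - \sum_(n < N) hnorm (p t (xi n)) ^+ 2 < e].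
Proof.
move=> /square_summableP[C hC] [m xm].
have /choice[om hom] : forall t, exists z, csum (fun n => ip (xi n) (p t (xi n))) z.
  move=> t; have [_ [M [M0 hM]]] := bounded_opP (rep_bounded hp t).
  apply: (@csum_dominated _ _ (fun n => M * hnorm (xi n) ^+ 2) (M * C)) => [n|N].
    apply: le_trans (cauchy_schwarz sH _ _) _; rewrite expr2 mulrCA.
    by rewrite ler_wpM2l ?hnorm_ge0.
  by rewrite -mulr_sumr ler_wpM2l.
have ipst t n : ip (xi n) (p (star t * t) (xi n)) = (hnorm (p t (xi n)) ^+ 2)%:C%C.
  by rewrite (rep_mul hp) -(rep_adj hp) (ip_hnorm sH).
have hst t := csum_real (fun n => sqr_ge0 (hnorm (p t (xi n))))
  (eq_ind _ (fun u => csum u _) (hom (star t * t)) _ (funext (ipst t))).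
have hom1 : csum (fun n => (hnorm (xi n) ^+ 2)%:C%C) (om 1).
  have := hom 1; congr (csum _ _); apply/funext => n.
  by rewrite (rep_one hp) (ip_hnorm sH).
have [om0 om_le _] := csum_real (fun n => sqr_ge0 (hnorm (xi n))) hom1.
(* [om 1] is the sum of the [hnorm (xi n) ^+ 2], positive because of the nonzero [xi m]. *)
pose W := complex.Re (om 1).
have W0 : 0 < W.
  apply: lt_le_trans (om_le m.+1); rewrite big_ord_recr /= ltr_wpDl //.
    by apply: sumr_ge0 => i _; exact: sqr_ge0.
  rewrite exprn_gt0 // lt_def hnorm_ge0 andbT.
  by apply: contraNneq xm => /(hnorm_eq0 hH) ->.
have WC : W%:C%C != 0 :> R[i] by apply/eqP => -[/eqP]; rewrite gt_eqF.
have oW : om 1 = W%:C%C by exact: ge0_real.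
exists (fun t => (W^-1)%:C%C * om t), W.
have ReW z : W * complex.Re ((W^-1)%:C%C * z) = complex.Re z.
  by rewrite ReZ mulrA mulfV ?mul1r // gt_eqF.
split=> // [|t N|t e e0].
- split.
  + move=> c a b /=; rewrite mulrCA -mulrDr; congr (_ * _).
    apply: csum_unique (hom _) _; have := csum_lin c (hom a) (hom b).
    by under eq_fun do rewrite -(ipZr sH) -(ipDr sH) -(rep_linear hp).
  + move=> a; case: (hst a) => h _ _.
    by rewrite mulr_ge0 // ler0c invr_ge0 ltW.
  + by rewrite oW -rmorphM mulVf ?gt_eqF.
- by rewrite ReW; case: (hst t).
- by rewrite ReW; case: (hst t) => _ _; exact.
Qed.

Section Generators.
Context (A0 : set A).
Hypotheses (A0_1 : A0 1) (A0_mul : forall a b, A0 a -> A0 b -> A0 (a * b))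
  (A0_star : forall a, A0 a -> A0 (star a))
  (A0_gen : range p `<=` commutant (commutant (p @` A0))).

Lemma lspan_image (L M : lmodType R[i]) (c : L -> M) (D : set L) y : linear c ->
  lspan (c @` D) y -> exists x, lspan D x /\ c x = y.
Proof.
move=> lc; move: y; apply: lspan_ind => [|_ [x Dx <-]]; last by exists x; split=> //; exact: sub_lspan.
have [l0 lD] := lspan_submod D; split=> [|a _ _ [x [Dx <-]] [y [Dy <-]]].
  by exists 0; split=> //; exact: lin0.
by exists (a *: x + y); split; [exact: lD | exact: lc].
Qed.

(** Ultrastrong approximation along one prescribed sequence: [density_total] gives density in the
    GNS space of its vector state, which is read back on [H] through the norm identity. *)
Lemma seminorm_dense (xi : nat -> H) t (e : R) : square_summable xi -> 0 < e ->
  exists t0, lspan A0 t0 /\ forall N, \sum_(n < N) hnorm (p (t - t0) (xi n)) ^+ 2 <= e.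
Proof.
move=> sxi e0.
(* If all [xi n] vanish there is no state to normalize, and [0] approximates. *)
have [nz|z] := pselect (exists n, xi n != 0); last first.
  have xi0 n : xi n = 0 by apply/eqP; apply: contrapT => h; apply: z; exists n; apply/negP.
  exists 0; split=> [|N]; first by case: (lspan_submod A0).
  rewrite big1 ?ltW // => i _; rewrite xi0 (lin0 (rep_linear_op hp _)) (hnorm0 sH).
  by rewrite expr0n.
have [om [W [som W0 le lim]]] := vector_state sxi nz.
have G := gnsP GNS som; set G0 := gns GNS om in G.
have sG := hilbert_semi (gns_hilbert G).
have clE a : complex.Re (om (star a * a)) = hnorm (gns_class G0 a) ^+ 2.
  by rewrite (hnorm_sq sG) (gns_ip G).
have tot := @density_total R A H G0 p (@gns_pi _ _ G0) (@gns_class _ _ G0) A0 xi W hH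
  (gns_hilbert G) hp (gns_rep G) (gns_linear G) (gns_act G) (gns_dense G)
  A0_1 A0_mul A0_star A0_gen W0.
have {}tot v : (forall a, A0 a -> ip v (gns_class G0 a) = 0) -> v = 0.
  by apply: tot => *; rewrite -clE; [exact: le | exact: lim].
(* The partial sums are at most [W] times the squared GNS norm of the error, whence this
   tolerance. *)
have e1 : 0 < Num.sqrt (e / W) by rewrite sqrtr_gt0 divr_gt0.
have /dense_lspan/(_ (gns_class G0 t) _ e1) : dense_span (@gns_class _ _ G0 @` A0).
  apply: total_dense (gns_hilbert G) _ => v hv; apply: tot => a Aa; apply: hv; by exists a.
move=> [_ [/(lspan_image (gns_linear G))[t0 [Dt0 <-]] h]].
exists t0; split=> // N; apply: le_trans (le _ _) _.
rewrite clE (linB (gns_linear G)) mulrC -ler_pdivlMr //.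
rewrite -(@sqr_sqrtr _ (e / W)) ?divr_ge0 ?(ltW e0) ?(ltW W0) //.
by rewrite ler_pXn2r ?nnegrE ?hnorm_ge0 ?(ltW e1) // ltW.
Qed.

(** If [xi] and [zeta] represent [h], then [polar_le] bounds the real part by a quarter of the
    squared seminorm of [xi + zeta], so approximation along this one sequence suffices. *)
Lemma normal_state_dense (h : A -> R[i]) t (e : R) : w_normal h -> 0 < e ->
  exists t0, lspan A0 t0 /\ complex.Re (h (star (t - t0) * (t - t0))) < e.
Proof.
move=> /normalP[xi [zeta [/square_summableP[C1 h1] /square_summableP[C2 h2] hh]]] e0.
have [|t0 [Dt0 ht0]] := @seminorm_dense (fun n => xi n + zeta n) t e _ e0.
  apply/square_summableP; exists (2 * C1 + 2 * C2) => N.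
  apply: (@le_trans _ _ (2 * \sum_(i < N) hnorm (xi i) ^+ 2 + 2 * \sum_(i < N) hnorm (zeta i) ^+ 2)).
    rewrite !mulr_sumr -big_split; apply: ler_sum => i _ /=.
    by rewrite -(parallelogram sH) lerDl sqr_ge0.
  by rewrite lerD // ler_wpM2l.
exists t0; split=> //; apply: (@le_lt_trans _ _ (4^-1 * e)); last lra.
apply: csum_Re_le (hh _) _ => N; rewrite Re_sum.
rewrite -ler_pdivrMl ?invr_gt0 // invrK mulr_sumr; apply: le_trans _ (ht0 N).
apply: ler_sum => i _; rewrite (rep_mul hp) -(rep_adj hp).
by rewrite (linD (rep_linear_op hp _)) (polar_le sH).
Qed.

(** Merges the right-hand sequences of two normal functionals, so that one approximant [t0] serves
    both. *)
Definition interleave (T : Type) (x y : nat -> T) n := if odd n then y n./2 else x n./2.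

Lemma sum_interleave (T : Type) (q : T -> R) (x y : nat -> T) N :
  \sum_(i < N.*2) q (interleave x y i) = \sum_(i < N) q (x i) + \sum_(i < N) q (y i).
Proof.
elim: N => [|N IH]; first by rewrite !big_ord0 addr0.
rewrite doubleS !big_ord_recr /= IH /interleave /= odd_double /= uphalf_double doubleK.
by rewrite -!addrA; congr (_ + _); rewrite addrCA.
Qed.

Lemma normal_eq (f1 f2 : A -> R[i]) : w_normal f1 -> w_normal f2 ->
  (forall a, A0 a -> f1 a = f2 a) -> f1 = f2.
Proof.
move=> n1 n2 f12; apply/funext => t.
have l1 : linear (f1 : A -> R[i]^o) := normal_scalar n1.
have l2 : linear (f2 : A -> R[i]^o) := normal_scalar n2.
have {}f12 a : lspan A0 a -> f1 a = f2 a.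
  move: a; apply: lspan_ind => //; split=> [|c a b ha hb] /=; first by rewrite (lin0 l1) (lin0 l2).
  by rewrite l1 l2 ha hb.
move: n1 n2 => /normalP[x1 [z1 [/square_summableP[C1 h1] /square_summableP[D1 k1] s1]]].
move=> /normalP[x2 [z2 [/square_summableP[C2 h2] /square_summableP[D2 k2] s2]]].
have sI : square_summable (interleave z1 z2).
  apply/square_summableP; exists (D1 + D2) => N.
  apply: le_trans (@sum_monotone _ (fun n => hnorm (interleave z1 z2 n) ^+ 2) _ _
    (fun n => sqr_ge0 _) (leq_addr N N)) _.
  by rewrite addnn (sum_interleave (fun y => hnorm y ^+ 2)) lerD.
apply/subr0_eq; apply: (@cabs_le0 _ _ (C1 + C2 + 2)) => e e0 e1.
have [t0 [Dt0 ht0]] := seminorm_dense t sI (exprn_gt0 2 e0).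
have ht N : \sum_(i < N) hnorm (p (t - t0) (z1 i)) ^+ 2 +
    \sum_(i < N) hnorm (p (t - t0) (z2 i)) ^+ 2 <= e ^+ 2.
  apply: le_trans (ht0 N.*2).
  by rewrite (sum_interleave (fun y => hnorm (p (t - t0) y) ^+ 2)).
(* Young's inequality with weight [e]: the left vectors contribute [e * C], and the tolerance
   [e ^+ 2] on the right vectors offsets the factor [e^-1]. *)
have bound (f : A -> R[i]) (x z : nat -> H) (C : R) :
    (forall N, \sum_(i < N) hnorm (x i) ^+ 2 <= C) ->
    (forall N, \sum_(i < N) hnorm (p (t - t0) (z i)) ^+ 2 <= e ^+ 2) ->
    (forall a, csum (fun n => ip (x n) (p a (z n))) (f a)) ->
    cabs (f (t - t0)) <= e * (C + 1).
  move=> hC hz hf; apply: csum_le (hf _) _ => N.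
  apply: (@le_trans _ _ (e * \sum_(i < N) hnorm (x i) ^+ 2 +
     e^-1 * \sum_(i < N) hnorm (p (t - t0) (z i)) ^+ 2)).
    rewrite !mulr_sumr -big_split; apply: ler_sum => i _ /=.
    apply: le_trans (cauchy_schwarz sH _ _) _.
    set a := hnorm _; set b := hnorm _.
    have : 0 <= (e * a - b) ^+ 2 + e ^+ 2 * a ^+ 2 + b ^+ 2.
      by rewrite -[e ^+ 2 * _]exprMn !addr_ge0 ?sqr_ge0.
    have -> : (e * a - b) ^+ 2 + e ^+ 2 * a ^+ 2 + b ^+ 2 =
      2 * e * (e * a ^+ 2 + e^-1 * b ^+ 2 - a * b) by field; rewrite gt_eqF.
    by rewrite pmulr_rge0 ?mulr_gt0 // subr_ge0.
  rewrite mulrDr lerD ?ler_wpM2l ?(ltW e0) //.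
  by rewrite ler_pdivrMl // mulr1 -expr2.
have b1 := bound f1 x1 z1 C1 h1 _ s1; have b2 := bound f2 x2 z2 C2 h2 _ s2.
rewrite -[t](subrK t0) (linD l1) (linD l2) (f12 t0) // opprD addrACA subrr addr0.
apply: le_trans (cabsD _ _) _; rewrite cabsN.
have -> : C1 + C2 + 2 = (C1 + 1) + (C2 + 1) by ring.
rewrite mulrDr lerD //; [apply: b1 | apply: b2] => N; apply: le_trans (ht N).
  by rewrite lerDl sumr_ge0 // => i _; exact: sqr_ge0.
by rewrite lerDr sumr_ge0 // => i _; exact: sqr_ge0.
Qed.

End Generators.

End NormalFunctionals.

(** * Spatial tensor products *)

Lemma riesz_functional (R : realType) (H : ipSpace R) (l : H -> R[i]) (M : R) :
  is_hilbert H -> scalar l -> (forall x, cabs (l x) <= M * hnorm x) ->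
  exists k, forall x, ip k x = l x.
Proof.
move=> hH hl hM; have [|k [_ hk _]] := @riesz R H H setT id l `|M| hH (conj I (fun _ _ _ _ _ => I))
   (fun _ _ _ => erefl) hl (normr_ge0 M).
  move=> x _; apply: le_trans (hM x) _.
  by rewrite ler_wpM2r ?hnorm_ge0 ?ler_norm.
by exists k => x; exact: hk.
Qed.

Definition determining (R : realType) (M : wstar R) (A0 : set M) :=
  forall f1 f2 : M -> R[i], w_normal f1 -> w_normal f2 ->
    (forall a, A0 a -> f1 a = f2 a) -> f1 = f2.

Section SpatialTensor.
Context (R : realType) (HT : hilbert_tensor R) (WT : wstar_tensor HT)
  (GNS : gns_choice R) (M N : wstar R).
Local Notation e := (@wt_pure R HT WT M N).

(** Only the left leg is restricted: with [A0] itself made of elementary tensors, this yields the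
    threefold ones. *)
Definition elementary (A0 : set M) : set (WT M N) :=
  [set t | exists a b, A0 a /\ t = wt_pure WT a b].

Section Realized.
Context (H K : ipSpace R) (p : M -> H -> H) (q : N -> K -> K)
  (r : WT M N -> HT H K -> HT H K).
Hypotheses (rzM : is_realization (@w_normal R M) p)
  (rzN : is_realization (@w_normal R N) q)
  (rzT : is_realization (@w_normal R (WT M N)) r)
  (rE : forall a b x y, r (e a b) (ht_pure HT x y) = ht_pure HT (p a x) (q b y))
  (rgen : range r = commutant (commutant [set W | exists a b, W = r (e a b)])).

Let hH := rz_hilbert rzM.
Let hK := rz_hilbert rzN.
Let hHK := rz_hilbert rzT.
Let sHK := hilbert_semi hHK.
Let hp := rz_rep rzM.
Let hq := rz_rep rzN.
Let hr := rz_rep rzT.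

Lemma pure_orth (v : HT H K) : (forall x y, ip v (ht_pure HT x y) = 0) -> v = 0.
Proof.
move=> hv; apply: (dense_total hHK (@ht_dense R HT H K hH hK)) => _ [x [y ->]].
exact: hv.
Qed.

(** Identities in the tensor product are checked on elementary vectors: bounded operators agreeing
    there coincide, and [r] is injective. *)
Lemma realized_ext t t' : (forall x y, r t (ht_pure HT x y) = r t' (ht_pure HT x y)) -> t = t'.
Proof.
move=> h; apply: (rz_inj rzT).
exact: (bounded_pure_eq hH hK hHK (dense_id hH) (dense_id hK) (rep_bounded hr t) (rep_bounded hr t')).
Qed.

Lemma realized_mul a b a' b' : e a b * e a' b' = e (a * a') (b * b').
Proof.
by apply: realized_ext => x y; rewrite (rep_mul hr) !rE (rep_mul hp) (rep_mul hq).
Qed.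

Lemma realized_one : e 1 1 = 1.
Proof. by apply: realized_ext => x y; rewrite rE (rep_one hr) (rep_one hp) (rep_one hq). Qed.

Lemma realized_star a b : star (e a b) = e (star a) (star b).
Proof.
apply: realized_ext => x y; apply/subr0_eq/pure_orth => x' y'.
rewrite (ipBl sHK) (rep_star hr) !rE !ht_ip //.
by rewrite (rep_star hp) (rep_star hq) subrr.
Qed.

(** Restricting the left legs to [A0] does not enlarge the commutant: the coefficients of both sides
    of the commutation relation are vector functionals on [M], and these agree once they agree on
    [A0]. *)
Lemma realized_gen (A0 : set M) : determining A0 ->
  range r `<=` commutant (commutant (r @` elementary A0)).
Proof.
move=> dA0; rewrite rgen => T [bT hT]; split=> // X [bX hX]; apply: hT; split=> // _ [x [c ->]].
have XC a : A0 a -> X \o r (e a c) = r (e a c) \o X.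
  by move=> Aa; apply: hX; exists (e a c) => //; exists a, c.
apply: (bounded_pure_eq hH hK hHK (dense_id hH) (dense_id hK)).
- exact: bounded_comp bX (rep_bounded hr _).
- exact: bounded_comp (rep_bounded hr _) bX.
move=> y z /=; apply/subr0_eq/pure_orth => y' z'.
set v := ht_pure HT y' z'; set w := X (ht_pure HT y z).
have [lX [C [C0 hC]]] := bounded_opP bX.
(* Slice vectors: [k] represents the coefficient of [X] after [r (e a c)], and [k'], built with
   [star c], that of [r (e a c)] after [X]. *)
have [k hk] : exists k, forall u, ip k u = ip v (X (ht_pure HT u (q c z))).
  apply: (@riesz_functional _ _ _ (hnorm v * (C * hnorm (q c z))) hH) => [a u u'|u] /=.
    by rewrite (ht_linearl HT hH hK) lX (ipDr sHK) (ipZr sHK).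
  apply: le_trans (cauchy_schwarz sHK _ _) _; rewrite -mulrA ler_wpM2l ?hnorm_ge0 //.
  by apply: le_trans (hC _) _; rewrite hnorm_pure // -mulrA [hnorm u * _]mulrC.
have [k' hk'] : exists k', forall u, ip k' u = ip w (ht_pure HT u (q (star c) z')).
  apply: (@riesz_functional _ _ _ (hnorm w * hnorm (q (star c) z')) hH) => [a u u'|u] /=.
    by rewrite (ht_linearl HT hH hK) (ipDr sHK) (ipZr sHK).
  apply: le_trans (cauchy_schwarz sHK _ _) _; rewrite hnorm_pure //.
  by rewrite -mulrA [hnorm u * _]mulrC.
have phi1 a : ip k (p a y) = ip v (X (r (e a c) (ht_pure HT y z))) by rewrite hk rE.
have phi2 a : ip y' (p a k') = ip v (r (e a c) w).
  rewrite -(rep_star hp) (ip_conj hH) hk' -rE -realized_star -(ip_conj hHK).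
  by rewrite (rep_star hr).
have /(congr1 (@^~ x)) /= E : (fun a => ip k (p a y)) = (fun a => ip y' (p a k')).
  apply: dA0; [exact: (normal_rank1 rzM) | exact: (normal_rank1 rzM) |].
  move=> a Aa; rewrite phi1 phi2; congr (ip v _).
  exact: (congr1 (@^~ (ht_pure HT y z)) (XC a Aa)).
rewrite (ip_conj hHK) (ipBr sHK) -phi1 E phi2 subrr.
exact: rmorph0.
Qed.

End Realized.

Lemma tensor_mul a b a' b' : e a b * e a' b' = e (a * a') (b * b').
Proof.
have [H [K [p [q [r [h1 h2 h3 h4 h5]]]]]] := wt_spatial WT M N.
exact: realized_mul h1 h2 h3 h4 _ _ _ _.
Qed.

Lemma tensor_one : e 1 1 = 1.
Proof.
have [H [K [p [q [r [h1 h2 h3 h4 h5]]]]]] := wt_spatial WT M N.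
exact: realized_one h1 h2 h3 h4.
Qed.

Lemma tensor_star a b : star (e a b) = e (star a) (star b).
Proof.
have [H [K [p [q [r [h1 h2 h3 h4 h5]]]]]] := wt_spatial WT M N.
exact: realized_star h1 h2 h3 h4 _ _.
Qed.

Section Generators.
Context (A0 : set M).
Hypotheses (A0_1 : A0 1) (A0_mul : forall a b, A0 a -> A0 b -> A0 (a * b))
  (A0_star : forall a, A0 a -> A0 (star a)) (A0_det : determining A0).

Let E1 : elementary A0 1.
Proof. by exists 1, 1; rewrite -tensor_one. Qed.
Let EM s t : elementary A0 s -> elementary A0 t -> elementary A0 (s * t).
Proof.
move=> [a [b [Aa ->]]] [a' [b' [Aa' ->]]]; exists (a * a'), (b * b').
by rewrite -tensor_mul; split=> //; exact: A0_mul.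
Qed.
Let Es t : elementary A0 t -> elementary A0 (star t).
Proof.
move=> [a [b [Aa ->]]]; exists (star a), (star b).
by rewrite -tensor_star; split=> //; exact: A0_star.
Qed.

Lemma elementary_determining : determining (elementary A0).
Proof.
have [H [K [p [q [r [h1 h2 h3 h4 h5]]]]]] := wt_spatial WT M N.
move=> f1 f2; exact: (normal_eq GNS h3 E1 EM Es (realized_gen h1 h2 h3 h4 h5 A0_det)).
Qed.

Lemma elementary_dense (h : WT M N -> R[i]) t (eps : R) : w_normal h -> 0 < eps ->
  exists t0, lspan (elementary A0) t0 /\ complex.Re (h (star (t - t0) * (t - t0))) < eps.
Proof.
have [H [K [p [q [r [h1 h2 h3 h4 h5]]]]]] := wt_spatial WT M N.
exact: (normal_state_dense GNS h3 E1 EM Es (realized_gen h1 h2 h3 h4 h5 A0_det)).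
Qed.

End Generators.

Lemma determiningT : determining [set: M].
Proof. by move=> f1 f2 _ _ h; apply/funext => a; exact: h. Qed.

End SpatialTensor.

(** * States on a continuous tensor product system *)

Section Isomorphisms.
Context (R : realType) (M N : wstar R) (g : M -> N).
Hypothesis hg : is_wiso g.

Lemma wiso_surj y : exists x, g x = y.
Proof. by case: (iso_bij hg) => k _ kK; exists (k y). Qed.

Lemma inv_ofK x : inv_of g (g x) = x.
Proof.
apply: (bij_inj (iso_bij hg)).
by apply: (@xgetPex _ 0 [set a : M | g a = g x]); exists x.
Qed.

End Isomorphisms.

Section TensorSystem.
Context (R : realType) (HT : hilbert_tensor R) (WT : wstar_tensor HT)
  (GNS : gns_choice R) (B : ctps WT).

(* [el_tensor] with a free target, so that associativity needs no transport. *)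
Definition el_at (s t w : R) (a : B 0 s) (b : B 0 t) : B 0 w :=
  ct_gamma B 0 s w (wt_pure WT a (ct_beta B 0 t s w b)).

Section At.
Context (s t w : R).
Hypotheses (s0 : 0 < s) (t0 : 0 < t) (wE : w = s + t).

Lemma shift_at : is_shift s 0 t s w.
Proof. by split; [exact: ltW | rewrite add0r | rewrite wE addrC]. Qed.
Lemma beta_at : is_wiso (ct_beta B 0 t s w).
Proof. exact: ct_beta_iso shift_at. Qed.
Lemma gamma_at : is_wiso (ct_gamma B 0 s w).
Proof. by apply: ct_gamma_iso => //; rewrite wE ltrDl. Qed.

Lemma el_at_surj (x : WT (B 0 s) (B s w)) : elementary setT x ->
  exists (a : B 0 s) (b : B 0 t), ct_gamma B 0 s w x = el_at w a b.
Proof.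
by move=> [a [b' [_ ->]]]; have [b <-] := wiso_surj beta_at b'; exists a, b.
Qed.

Lemma el_at_mul (a a' : B 0 s) (b b' : B 0 t) : el_at w a b * el_at w a' b' = el_at w (a * a') (b * b').
Proof. by rewrite /el_at (iso_mul beta_at) -tensor_mul (iso_mul gamma_at). Qed.
Lemma el_at_one : el_at w (1 : B 0 s) (1 : B 0 t) = 1.
Proof. by rewrite /el_at (iso_one beta_at) tensor_one (iso_one gamma_at). Qed.
Lemma el_at_star (a : B 0 s) (b : B 0 t) : star (el_at w a b) = el_at w (star a) (star b).
Proof. by rewrite /el_at (iso_star beta_at) -tensor_star (iso_star gamma_at). Qed.

Lemma el_at_determining (A0 : set (B 0 s)) : A0 1 ->
  (forall a b, A0 a -> A0 b -> A0 (a * b)) -> (forall a, A0 a -> A0 (star a)) ->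
  determining A0 -> determining [set x : B 0 w | exists a (b : B 0 t), A0 a /\ x = el_at w a b].
Proof.
move=> A1 AM As dA f1 f2 n1 n2 h; apply/funext => y.
have [x <-] := wiso_surj gamma_at y.
have m1 := (iso_normal gamma_at f1).1 n1; have m2 := (iso_normal gamma_at f2).1 n2.
have := elementary_determining GNS A1 AM As dA m1 m2.
move=> /(_ _)/(congr1 (@^~ x)); apply => _ [a [b' [Aa ->]]] /=.
have [b <-] := wiso_surj beta_at b'; apply: h; by exists a, b.
Qed.

End At.

(** After [ct_gamma_assoc], the shift of [c] by [r + s] is split into one by [s] followed by one by
    [r]; compatibility of [gamma] with shifts then pulls the shift by [r] out of the right
    factor. *)
Lemma el_at_assoc (r s t w : R) (a : B 0 r) (b : B 0 s) (c : B 0 t) :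
  0 < r -> 0 < s -> 0 < t -> w = r + (s + t) ->
  el_at w (el_at (r + s) a b) c = el_at w a (el_at (s + t) b c).
Proof.
move=> r0 s0 t0 wE; rewrite /el_at.
rewrite -ct_gamma_assoc //; [|by rewrite ltrDl|by rewrite wE addrA ltrDl].
congr (ct_gamma B 0 r w (wt_pure WT a _)).
have <- := @ct_beta_comp _ _ _ B s r 0 t s (s + t) (r + s) w (lexx _) t0.
- apply: (@ct_gamma_beta _ _ _ B r 0 s (s + t)) => //; first by rewrite ltrDl.
  + by split; [exact: ltW | rewrite add0r | rewrite addrC].
  + by split; [exact: ltW | rewrite addrC | rewrite wE addrC].
- by split; [exact: ltW | rewrite add0r | rewrite addrC].
- by split; [exact: ltW | rewrite addrC | rewrite wE addrC].
Qed.

Definition alg_cast (u w : R) (e : u = w) : B 0 u -> B 0 w :=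
  match e in _ = w return B 0 u -> B 0 w with erefl => id end.

Lemma alg_cast_el (s t u w : R) (e : u = w) (a : B 0 s) (b : B 0 t) :
  alg_cast e (el_at u a b) = el_at w a b.
Proof. by case: w / e. Qed.

Section States.
Context (S : forall s t : R, set (B s t -> R[i])).
Hypothesis hS : stationary_factorizing GNS S.

Lemma S_normal (t : R) (f : B 0 t -> R[i]) : 0 < t -> S f -> is_normal_state f.
Proof. exact: (sf_normal hS). Qed.

Section Pair.
Context (s t : R) (s0 : 0 < s) (t0 : 0 < t) (f : B 0 s -> R[i]) (g : B 0 t -> R[i]).
Hypotheses (hf : S f) (hg : S g).

Lemma S_tensor : S (st_tensor f g).
Proof. exact: (sf_tensor hS). Qed.

Let st0 : 0 < s + t := addr_gt0 s0 t0.
Let gT := gnsP GNS (S_normal st0 S_tensor).1.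
Let gf := gnsP GNS (S_normal s0 hf).1.
Let gg := gnsP GNS (S_normal t0 hg).1.

(* If no normal functional extended [f (x) g] then [st_tensor f g] would be the
   default value 0, which is not a state. *)
Lemma st_tensorE a b : st_tensor f g (el_at (s + t) a b) = f a * g b.
Proof.
have [[_ _ one] _] := S_normal st0 S_tensor.
rewrite /st_tensor /= /el_at inv_ofK; last exact: (gamma_at s0 t0 erefl).
have hb := beta_at s0 t0 (erefl (s + t)).
pose P := [set h : WT (B 0 s) (B s (s + t)) -> R[i] | w_normal h /\
  forall a b, h (wt_pure WT a b) = f a * (g \o inv_of (ct_beta B 0 t s (s + t))) b].
have [exP|nP] := pselect (exists h, P h).
  by have [_ E] := xgetPex (fun=> 0) exP; rewrite /wt_functional E /= inv_ofK.
have : st_tensor f g = fun=> 0.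
  apply/funext => x; rewrite /st_tensor /= /wt_functional xgetPN // => h Ph.
  by apply: nP; exists h.
move=> /(congr1 (@^~ 1)); rewrite one => /eqP; rewrite oner_eq0 //.
Qed.

(** This yields surjectivity of [gns_V]. The GNS norm of [st_tensor f g] pulls back along [gamma] to
    the seminorm of a normal functional on the tensor product, where [elementary_dense] applies. *)
Lemma el_dense : dense_span (range (fun ab : B 0 s * B 0 t =>
  gns_class (gns GNS (st_tensor f g)) (el_at (s + t) ab.1 ab.2))).
Proof.
have hG := gns_hilbert gT; have sG := hilbert_semi hG; have lG := gns_linear gT.
apply: total_dense => // v hv; apply: (dense_total hG (gns_dense gT)) => _ [y _ <-].
have gam := gamma_at s0 t0 (erefl (s + t)).
have [x xy] := wiso_surj gam y.
have nor := (iso_normal gam (st_tensor f g)).1 (S_normal st0 S_tensor).2.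
apply: (@cabs_le0 _ _ (hnorm v)) => eps eps0 _.
have [x0 [Dx0 hx0]] := elementary_dense GNS (A0 := setT) I (fun _ _ _ _ => I)
  (fun _ _ => I) (@determiningT _ _) x nor (exprn_gt0 2 eps0).
have vx0 : ip v (gns_class (gns GNS (st_tensor f g)) (ct_gamma B 0 s (s + t) x0)) = 0.
  move: x0 Dx0 {hx0}; apply: lspan_ind => [|x1 /(el_at_surj s0 t0 erefl)[a [b ->]]].
    split=> [|c x1 x2 /= h1 h2]; rewrite /= ?(lin0 (iso_linear gam)) ?(lin0 lG) ?(ip0r sG) //.
    by rewrite (iso_linear gam) lG (ipDr sG) (ipZr sG) h1 h2 mulr0 addr0.
  by apply: hv; exists (a, b).
rewrite -[gns_class _ y](subrK (gns_class (gns GNS (st_tensor f g)) (ct_gamma B 0 s (s + t) x0))).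
rewrite (ipDr sG) vx0 addr0; apply: le_trans (cauchy_schwarz sG _ _) _.
rewrite mulrC ler_wpM2r ?hnorm_ge0 // -(@ler_pXn2r _ 2) ?nnegrE ?hnorm_ge0 ?(ltW eps0) //.
rewrite -(linB lG) (hnorm_sq sG) (gns_ip gT) -xy -(linB (iso_linear gam)).
by rewrite -(iso_star gam) -(iso_mul gam) ltW.
Qed.

(** The Gram matrices agree because [star (el_at w a b) * el_at w a' b'] is again elementary and the
    state factorizes on it. *)
Lemma gns_VP : unitary_op (gns_V (GNS := GNS) (f := f) (g := g)) /\
  forall a b, gns_V (ht_pure HT (gns_class (gns GNS f) a) (gns_class (gns GNS g) b)) =
    gns_class (gns GNS (st_tensor f g)) (el_at (s + t) a b).
Proof.
apply: (@xgetPex _ (fun=> 0)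
    [set W : HT (gns GNS f) (gns GNS g) -> gns GNS (st_tensor f g) |
      unitary_op W /\
      forall a b, W (ht_pure HT (gns_class (gns GNS f) a) (gns_class (gns GNS g) b))
                  = gns_class (gns GNS (st_tensor f g)) (el_tensor a b)]).
have hf' := gns_hilbert gf; have hg' := gns_hilbert gg.
have [||[a b] [a' b'] /=|T [uT hT]] := gram_unitary (ht_hilbert HT hf' hg') (gns_hilbert gT)
  (phi := fun ab : B 0 s * B 0 t => ht_pure HT (gns_class (gns GNS f) ab.1) (gns_class (gns GNS g) ab.2))
  (psi := fun ab : B 0 s * B 0 t => gns_class (gns GNS (st_tensor f g)) (el_at (s + t) ab.1 ab.2)).
- exact: (dense_pure hf' hg' (gns_dense gf) (gns_dense gg)).
- exact: el_dense.
- rewrite ht_ip // (gns_ip gf) (gns_ip gg) (gns_ip gT).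
  by rewrite el_at_star // el_at_mul // st_tensorE.
- by exists T; split=> // a b; exact: (hT (a, b)).
Qed.

End Pair.

(** [F] stands for the state of the other bracketing. Keeping [w] a variable lets [e] be eliminated;
    both sides then live on one algebra and are compared on threefold elementary tensors. *)
Lemma st_tensor_assoc (r s t w : R) (e : r + (s + t) = w)
    (f : B 0 r -> R[i]) (g : B 0 s -> R[i]) (h : B 0 t -> R[i]) (F : B 0 w -> R[i]) :
  0 < r -> 0 < s -> 0 < t -> S f -> S g -> S h -> w_normal F ->
  (forall a b c, F (el_at w (el_at (r + s) a b) c) = f a * g b * h c) ->
  forall y, F (alg_cast e y) = st_tensor f (st_tensor g h) y.
Proof.
move=> r0 s0 t0 hf hg hh; case: w / e F => F nF hF y /=.
have st0 : 0 < s + t by exact: addr_gt0.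
have rs0 : 0 < r + s by exact: addr_gt0.
have hgh := S_tensor s0 t0 hg hh.
have [_ n2] := S_normal (addr_gt0 r0 st0) (S_tensor r0 st0 hf hgh).
have d1 : determining [set x : B 0 (r + s) | exists a (b : B 0 s), [set: B 0 r] a /\ x = el_at (r + s) a b].
  by apply: el_at_determining => //; exact: determiningT.
have := @el_at_determining (r + s) t (r + (s + t)) rs0 t0 (addrA _ _ _) _ _ _ _ d1 _ _ nF n2.
move=> /(_ _ _ _ _)/(congr1 (@^~ y)); apply.
- by exists 1, 1; rewrite el_at_one.
- move=> _ _ [a [b [_ ->]]] [a' [b' [_ ->]]]; exists (a * a'), (b * b').
  by rewrite el_at_mul.
- by move=> _ [a [b [_ ->]]]; exists (star a), (star b); rewrite el_at_star.
- move=> _ [_ [c [[a [b [_ ->]]] ->]]]; rewrite hF el_at_assoc //.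
  by rewrite (st_tensorE r0 st0 hf hgh) (st_tensorE s0 t0 hg hh) mulrA.
Qed.

End States.

End TensorSystem.

(** * The product system *)

Section Casts.
Context (R : realType).

Lemma cast_unitary (H K : ipSpace R) (e : H = K) : unitary_op (ip_cast e).
Proof. by case: K / e; split=> // y; exists y. Qed.

Lemma cast_linear (H K : ipSpace R) (e : H = K) : linear (ip_cast e).
Proof. by case: (cast_unitary e). Qed.

Lemma cast_cast (H K L : ipSpace R) (e : H = K) (e' : K = L) (e'' : H = L) x :
  ip_cast e' (ip_cast e x) = ip_cast e'' x.
Proof.
by case: K / e e' => e'; rewrite (Prop_irrelevance e' e'').
Qed.

End Casts.

Section ProductSystem.
Context (R : realType) (HT : hilbert_tensor R)
    (WT : wstar_tensor HT) (GNS : gns_choice R) (B : ctps WT)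
    (S : forall s t : R, set (B s t -> R[i]))
    (hS : stationary_factorizing GNS S)
    (U : forall (t : R) (f g : B 0 t -> R[i]), {linear gns GNS f -> gns GNS g})
    (U_unitary : forall (t : R) (f g : B 0 t -> R[i]),
       0 < t -> S 0 t f -> S 0 t g -> unitary_op (U t f g))
    (U_id : forall (t : R) (f : B 0 t -> R[i]),
       0 < t -> S 0 t f -> forall x, U t f f x = x)
    (U_comp : forall (t : R) (f g h : B 0 t -> R[i]),
       0 < t -> S 0 t f -> S 0 t g -> S 0 t h ->
       forall x, U t g h (U t f g x) = U t f h x)
    (U_factorizes : forall (s t : R) (f f' : B 0 s -> R[i]) (g g' : B 0 t -> R[i]),
       0 < s -> 0 < t -> S 0 s f -> S 0 s f' -> S 0 t g -> S 0 t g' ->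
       forall x : HT (gns GNS f) (gns GNS g),
         U (s + t) (st_tensor f g) (st_tensor f' g') (gns_V x) =
         gns_V (ht_map (U s f f') (U t g g') x)).

Arguments U : clear implicits.

Local Notation E := (Espace S U).
Local Notation S0 := (S0 S).

Section Positive.
Context (t : R) (t0 : 0 < t).

Lemma gns_S (f : S0 t) : is_gns (sval f) (gns GNS (sval f)).
Proof. by apply: gnsP; case: (S_normal hS t0 (svalP f)). Qed.

Lemma hilbert_S (f : S0 t) : is_hilbert (gns GNS (sval f)).
Proof. exact: gns_hilbert (gns_S f). Qed.

Lemma S0_inhabited : exists f : S0 t, True.
Proof. by have [f Sf] := sf_nonempty hS (lexx 0) t0; exists (exist _ f Sf). Qed.

Lemma Ecomp_coh (psi : E t) (f g : S0 t) :
  Ecomp t0 psi g = U t (sval f) (sval g) (Ecomp t0 psi f).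
Proof.
(* Generalizing the boolean [0 < t] together with its proof makes [Ebool] compute; the case [false]
   is absurd. *)
rewrite /Ecomp; move: psi; rewrite /Espace; move: (0 < t) (t0) => [] // h psi /=.
exact: cohP.
Qed.

Lemma Ecomp_inj (psi phi : E t) (f : S0 t) : Ecomp t0 psi f = Ecomp t0 phi f -> psi = phi.
Proof.
rewrite /Ecomp; move: psi phi; rewrite /Espace; move: (0 < t) (t0) => [] // h psi phi /=.
exact: coh_inj.
Qed.

Lemma Ecomp_unitary (f : S0 t) : unitary_op (fun psi : E t => Ecomp t0 psi f).
Proof.
have h : unitary_op (fun x : coh_space (fun f g : S0 t => U t (sval f) (sval g)) => coh_fun x f).
  apply: coh_unitary => *.
  - by apply: U_unitary => //; exact: svalP.
  - by apply: U_id => //; exact: svalP.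
  - by apply: U_comp => //; exact: svalP.
rewrite /Ecomp; rewrite /Espace; move: (0 < t) (t0) => [] // _ /=; exact: h.
Qed.

Lemma Ecomp_surj (f : S0 t) v : exists psi : E t, Ecomp t0 psi f = v.
Proof. by case: (Ecomp_unitary f) => _ _; apply. Qed.

Lemma Ecomp_ip (f : S0 t) (psi phi : E t) : ip psi phi = ip (Ecomp t0 psi f) (Ecomp t0 phi f).
Proof. by case: (Ecomp_unitary f). Qed.

Lemma E_hilbert_pos : is_hilbert (E t).
Proof.
have [f _] := S0_inhabited; apply: (hilbert_transport (Ecomp_unitary f) (hilbert_S f)).
by move=> psi phi; exact: Ecomp_inj.
Qed.

Lemma E_separable_pos : is_separable (E t).
Proof.
have [f _] := S0_inhabited; apply: (separable_transport (Ecomp_unitary f)).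
exact: (sf_separable hS t0 (svalP f)).
Qed.

Lemma Ecomp_dense (f : S0 t) (I : Type) (c : I -> E t) :
  dense_span (range (fun i => Ecomp t0 (c i) f)) -> dense_span (range c).
Proof.
move=> d; apply: (total_dense E_hilbert_pos) => v hv.
apply: (@Ecomp_inj _ _ f); rewrite (lin0 (let: And3 l _ _ := Ecomp_unitary f in l)).
apply: (dense_total (hilbert_S f) d) => _ [i _ <-].
by rewrite -Ecomp_ip; apply: hv; exists i.
Qed.

Lemma E_classes (f : S0 t) : exists c : B 0 t -> E t,
  (forall a, Ecomp t0 (c a) f = gns_class (gns GNS (sval f)) a) /\ dense_span (range c).
Proof.
have /choice[c hc] := fun a => @Ecomp_surj f (gns_class (gns GNS (sval f)) a).
exists c; split=> //; apply: (@Ecomp_dense f).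
by rewrite (funext hc : (fun i => Ecomp t0 (c i) f) = _); exact: gns_dense (gns_S f).
Qed.

End Positive.

Lemma E0eq : Cspace R = E 0.
Proof. by rewrite /Espace ltxx. Qed.

Lemma E_hilbert (t : R) : 0 <= t -> is_hilbert (E t).
Proof.
rewrite le_eqVlt => /predU1P[<-|]; last exact: E_hilbert_pos.
by case: _ / E0eq; exact: Cspace_hilbert.
Qed.

Lemma E_separable (t : R) : 0 <= t -> is_separable (E t).
Proof.
rewrite le_eqVlt => /predU1P[<-|]; last exact: E_separable_pos.
by case: _ / E0eq; exact: Cspace_separable.
Qed.

(** One pair [f], [g] defines [W]; [U_factorizes] carries the rule to every other pair. *)
Lemma multiplication_pos (s t : R) : 0 < s -> 0 < t ->
  exists W : HT (E s) (E t) -> E (s + t), unitary_op W /\ multiplication_rule W.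
Proof.
move=> s0 t0; have st0 := addr_gt0 s0 t0.
have hs := E_hilbert_pos s0; have ht := E_hilbert_pos t0; have hst := E_hilbert_pos st0.
have [f _] := S0_inhabited s0; have [g _] := S0_inhabited t0.
have Sfg := S_tensor hS s0 t0 (svalP f) (svalP g).
pose fg : S0 (s + t) := exist _ _ Sfg.
have [uV _] := gns_VP hS s0 t0 (svalP f) (svalP g).
have hf := hilbert_S s0 f; have hg := hilbert_S t0 g; have hfg := hilbert_S st0 fg.
have /choice[psi hpsi] : forall xy : E s * E t, exists z : E (s + t), Ecomp st0 z fg =
    gns_V (ht_pure HT (Ecomp s0 xy.1 f) (Ecomp t0 xy.2 g)).
  by move=> xy; exact: Ecomp_surj.
have [||[x y] [x' y'] /=|W [uW hW]] := gram_unitary (ht_hilbert HT hs ht) hst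
  (phi := fun xy : E s * E t => ht_pure HT xy.1 xy.2) (psi := psi).
- exact: dense_pure (dense_id hs) (dense_id ht).
(* As [gns_V] is onto, a vector orthogonal to all products lifts to one orthogonal to all elementary
   tensors. *)
- apply: (@Ecomp_dense _ st0 fg); rewrite (funext hpsi : (fun i => Ecomp st0 (psi i) fg) = _).
  apply: total_dense => // v hv; have [w wv] := let: And3 _ _ h := uV in h v.
  rewrite -wv; suff -> : w = 0 by rewrite (lin0 (let: And3 h _ _ := uV in h)).
  apply: (dense_total (ht_hilbert HT hf hg) (@ht_dense R HT _ _ hf hg)) => _ [x [y ->]].
  have [x' <-] := Ecomp_surj s0 x; have [y' <-] := Ecomp_surj t0 y.
  case: (uV) => _ <- _; rewrite wv; apply: hv; by exists (x', y').
- rewrite (Ecomp_ip st0 fg) !hpsi /=; case: (uV) => _ -> _.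
  by rewrite !ht_ip // -!Ecomp_ip.
exists W; split=> // s1 t1 st1 x y f' g' Sfg'.
rewrite (bool_irrelevance s1 s0) (bool_irrelevance t1 t0) (bool_irrelevance st1 st0).
rewrite (hW (x, y)) (Ecomp_coh st0 _ fg) hpsi /= U_factorizes //; try exact: svalP.
have uf : unitary_op (U s (sval f) (sval f')) by apply: U_unitary => //; exact: svalP.
have ug : unitary_op (U t (sval g) (sval g')) by apply: U_unitary => //; exact: svalP.
have [_ ->] := ht_mapP HT hf hg (hilbert_S s0 f') (hilbert_S t0 g') uf ug.
by rewrite -!Ecomp_coh.
Qed.

(** Joins the positive and the trivial cases so that one description selects the multiplication for
    each pair of indices. Quantifying over the equality proofs frees the clauses from a particular
    transport. *)
Definition Vspec (s t : R) (W : HT (E s) (E t) -> E (s + t)) : Prop :=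
  [/\ unitary_op W, 0 < s -> 0 < t -> multiplication_rule W,
    s = 0 -> forall (e : Cspace R = E s) (e' : E t = E (s + t)) c x,
      W (ht_pure HT (ip_cast e c) x) = ip_cast e' ((c : R[i]) *: x)
  & t = 0 -> forall (e : Cspace R = E t) (e' : E s = E (s + t)) c x,
      W (ht_pure HT x (ip_cast e c)) = ip_cast e' ((c : R[i]) *: x)].

(** At [s = t = 0] both triviality clauses apply; they agree because scalars commute. *)
Lemma cast_scale (t : R) (e : Cspace R = E t) (c d : Cspace R) :
  (c : R[i]) *: ip_cast e d = (d : R[i]) *: ip_cast e c.
Proof.
by rewrite -!(linZ (cast_linear e)); congr (ip_cast e _); exact: mulrC.
Qed.

Lemma Vspec_ex (s t : R) : 0 <= s -> 0 <= t -> exists W, @Vspec s t W.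
Proof.
move=> s0 t0; have hs := E_hilbert s0; have ht := E_hilbert t0.
have hst := E_hilbert (addr_ge0 s0 t0).
have us := let: And3 _ _ h := cast_unitary E0eq in h.
have [sp|s00] : 0 < s \/ s = 0 by move: s0; rewrite le_eqVlt => /predU1P[<-|]; [right|left].
  have [tp|t00] : 0 < t \/ t = 0 by move: t0; rewrite le_eqVlt => /predU1P[<-|]; [right|left].
    have [W [uW mW]] := multiplication_pos sp tp.
    by exists W; split=> // e; exfalso; [move: sp | move: tp]; rewrite e ltxx.
  subst t; pose e1 := congr1 E (esym (addr0 s)).
  have [||[x c] [x' c'] /=|W [uW hW]] := gram_unitary (ht_hilbert HT hs ht) hst
    (phi := fun xc : E s * Cspace R => ht_pure HT xc.1 (ip_cast E0eq xc.2))
    (psi := fun xc : E s * Cspace R => ip_cast e1 ((xc.2 : R[i]) *: xc.1)).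
  - exact: dense_pure (dense_id hs) (dense_range_surj ht us).
  - apply: total_dense => // v hv; apply: (ip_eq0 hst).
    have [w wv] := let: And3 _ _ h := cast_unitary e1 in h v.
    by apply: hv; exists (w, 1) => //=; rewrite scale1r.
  - case: (cast_unitary e1) => _ -> _; rewrite ht_ip //.
    case: (cast_unitary E0eq) => _ -> _; rewrite (ipZl (hilbert_semi hs)) (ipZr (hilbert_semi hs)) /=.
    ring.
  exists W; split=> // [_|s00 e e' c x|_ e e' c x].
  - by rewrite ltxx.
  - subst s; have [d <-] := us x; rewrite (Prop_irrelevance e E0eq) (Prop_irrelevance e' e1).
    by rewrite (hW (ip_cast E0eq c, d)) /= cast_scale.
  - by rewrite (Prop_irrelevance e E0eq) (Prop_irrelevance e' e1) (hW (x, c)).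
subst s; pose e1 := congr1 E (esym (add0r t)).
have [||[c x] [c' x'] /=|W [uW hW]] := gram_unitary (ht_hilbert HT hs ht) hst
  (phi := fun cx : Cspace R * E t => ht_pure HT (ip_cast E0eq cx.1) cx.2)
  (psi := fun cx : Cspace R * E t => ip_cast e1 ((cx.1 : R[i]) *: cx.2)).
- exact: dense_pure (dense_range_surj hs us) (dense_id ht).
- apply: total_dense => // v hv; apply: (ip_eq0 hst).
  have [w wv] := let: And3 _ _ h := cast_unitary e1 in h v.
  by apply: hv; exists (1, w) => //=; rewrite scale1r.
- case: (cast_unitary e1) => _ -> _; rewrite ht_ip //.
  case: (cast_unitary E0eq) => _ -> _; rewrite (ipZl (hilbert_semi ht)) (ipZr (hilbert_semi ht)) /=.
  ring.
exists W; split=> // [|_ e e' c x|t00 e e' c x].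
- by rewrite ltxx.
- by rewrite (Prop_irrelevance e E0eq) (Prop_irrelevance e' e1) (hW (c, x)).
- subst t; have [d <-] := us x; rewrite (Prop_irrelevance e E0eq) (Prop_irrelevance e' e1).
  by rewrite (hW (d, ip_cast E0eq c)) /= cast_scale.
Qed.

Definition Vmul (s t : R) : HT (E s) (E t) -> E (s + t) := xget (fun=> 0) (@Vspec s t).

Lemma VmulP (s t : R) : 0 <= s -> 0 <= t -> Vspec (@Vmul s t).
Proof. by move=> s0 t0; apply: xgetPex; exact: Vspec_ex. Qed.

Lemma Vmul_unitary (s t : R) : 0 <= s -> 0 <= t -> unitary_op (@Vmul s t).
Proof. by move=> s0 t0; case: (VmulP s0 t0). Qed.

Lemma Vmul_rule (s t : R) : 0 < s -> 0 < t -> multiplication_rule (@Vmul s t).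
Proof. by move=> s0 t0; case: (VmulP (ltW s0) (ltW t0)) => _ h _ _; exact: h. Qed.

Lemma Vmul0l (t : R) (e : Cspace R = E 0) (e' : E t = E (0 + t)) c x : 0 <= t ->
  Vmul (ht_pure HT (ip_cast e c) x) = ip_cast e' ((c : R[i]) *: x).
Proof. by move=> t0; case: (VmulP (lexx 0) t0) => _ _ h _; exact: h. Qed.

Lemma Vmul0r (t : R) (e : Cspace R = E 0) (e' : E t = E (t + 0)) c x : 0 <= t ->
  Vmul (ht_pure HT x (ip_cast e c)) = ip_cast e' ((c : R[i]) *: x).
Proof. by move=> t0; case: (VmulP t0 (lexx 0)) => _ _ _ h; exact: h. Qed.

Lemma Vmul_castl (s s' t : R) (e : s = s') (e' : s + t = s' + t) x y :
  Vmul (ht_pure HT (ip_cast (congr1 E e) x) y) = ip_cast (congr1 E e') (Vmul (ht_pure HT x y)).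
Proof.
by case: s' / e e' => e'; rewrite (Prop_irrelevance e' erefl).
Qed.

Lemma Vmul_castr (s t t' : R) (e : t = t') (e' : s + t = s + t') x y :
  Vmul (ht_pure HT x (ip_cast (congr1 E e) y)) = ip_cast (congr1 E e') (Vmul (ht_pure HT x y)).
Proof.
by case: t' / e e' => e'; rewrite (Prop_irrelevance e' erefl).
Qed.

Lemma Vmul_class (s t : R) (s0 : 0 < s) (t0 : 0 < t) (st0 : 0 < s + t) (f : S0 s) (g : S0 t)
    (fg : S (st_tensor (sval f) (sval g))) x y a b :
  Ecomp s0 x f = gns_class _ a -> Ecomp t0 y g = gns_class _ b ->
  Ecomp st0 (Vmul (ht_pure HT x y)) (exist _ _ fg) =
    gns_class (gns GNS (st_tensor (sval f) (sval g))) (el_at (s + t) a b).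
Proof.
move=> xa yb; rewrite (Vmul_rule s0 t0 s0 t0) xa yb.
by have [_ ->] := gns_VP hS s0 t0 (svalP f) (svalP g).
Qed.

Lemma Ecomp_cast (u w : R) (e : u = w) (u0 : 0 < u) (w0 : 0 < w) (F : S0 u) (F' : S0 w) psi a :
  (forall y, sval F' (alg_cast e y) = sval F y) ->
  Ecomp u0 psi F = gns_class _ a ->
  Ecomp w0 (ip_cast (congr1 E e) psi) F' = gns_class _ (alg_cast e a).
Proof.
case: w / e w0 F' => w0 [F' SF'] /=; case: F => F SF /= FF'.
have {}FF' : F' = F by apply/funext.
subst F'; rewrite (Prop_irrelevance SF' SF) (bool_irrelevance w0 u0); exact.
Qed.

Lemma Vmul_linear (s t : R) : 0 <= s -> 0 <= t -> linear (@Vmul s t).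
Proof. by move=> s0 t0; case: (Vmul_unitary s0 t0). Qed.

Lemma Vmul_assoc (r s t : R) : 0 <= r -> 0 <= s -> 0 <= t ->
  forall x : HT (HT (E r) (E s)) (E t),
    Vmul (ht_map (@Vmul r s) id x) =
    ip_cast (congr1 E (addrA r s t)) (Vmul (ht_map id (@Vmul s t) (ht_assoc x))).
Proof.
move=> r0 s0 t0.
have hr := E_hilbert r0; have hs := E_hilbert s0; have ht := E_hilbert t0.
have rs0 := addr_ge0 r0 s0; have st0 := addr_ge0 s0 t0.
have hrs := E_hilbert rs0; have hst := E_hilbert st0.
have hrst := E_hilbert (addr_ge0 rs0 t0).
have hHrs := ht_hilbert HT hr hs; have hHst := ht_hilbert HT hs ht.
have uid (H : ipSpace R) : unitary_op (@id H) by split=> // y; exists y.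
have urs := Vmul_unitary r0 s0; have ust := Vmul_unitary s0 t0.
have [u1 m1] := ht_mapP HT hHrs ht hrs ht urs (uid _).
have [u2 m2] := ht_mapP HT hr hHst hr hst (uid _) ust.
have [u3 m3] := ht_assocP HT hr hs ht.
have b1 := bounded_comp (unitary_bounded (Vmul_unitary rs0 t0)) (unitary_bounded u1).
have b2 := bounded_comp (unitary_bounded (cast_unitary (congr1 E (addrA r s t))))
  (bounded_comp (unitary_bounded (Vmul_unitary r0 st0))
    (bounded_comp (unitary_bounded u2) (unitary_bounded u3))).
(* The families stay free: all vectors when an index vanishes, vectors with components [[a]] when
   all indices are positive. *)
have reduce (I J K : Type) (phi : I -> E r) (psi : J -> E s) (chi : K -> E t) :
    dense_span (range phi) -> dense_span (range psi) -> dense_span (range chi) ->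
    (forall i j k, Vmul (ht_pure HT (Vmul (ht_pure HT (phi i) (psi j))) (chi k)) =
       ip_cast (congr1 E (addrA r s t))
         (Vmul (ht_pure HT (phi i) (Vmul (ht_pure HT (psi j) (chi k)))))) ->
    forall x, Vmul (ht_map (@Vmul r s) id x) =
    ip_cast (congr1 E (addrA r s t)) (Vmul (ht_map id (@Vmul s t) (ht_assoc x))).
  move=> d1 d2 d3 h x.
  have := bounded_pure_eq hHrs ht hrst (dense_pure hr hs d1 d2) d3 b1 b2.
  move=> /(_ _)/(congr1 (@^~ x)); apply => -[i j] k /=.
  by rewrite m1 m3 m2 h.
have us := let: And3 _ _ h := cast_unitary E0eq in h.
have pos (u : R) : 0 <= u -> 0 < u \/ u = 0.
  by rewrite le_eqVlt => /predU1P[<-|]; [right|left].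
have [rp|r00] := pos _ r0; last first.
  subst r; apply: (reduce _ _ _ _ _ _ (dense_id hr) (dense_id hs) (dense_id ht)) => x y z.
  have [c <-] := us x.
  rewrite (Vmul0l _ (congr1 E (esym (add0r s)))) // (Vmul0l _ (congr1 E (esym (add0r (s + t))))) //.
  rewrite (Vmul_castl _ (congr1 (+%R^~ t) (esym (add0r s)))).
  rewrite (linZ (bounded_purel HT z hs ht).1) (linZ (Vmul_linear s0 t0)).
  symmetry; exact: cast_cast.
have [sp|s00] := pos _ s0; last first.
  subst s; apply: (reduce _ _ _ _ _ _ (dense_id hr) (dense_id hs) (dense_id ht)) => x y z.
  have [c <-] := us y.
  rewrite (Vmul0l _ (congr1 E (esym (add0r t)))) // (Vmul0r _ (congr1 E (esym (addr0 r)))) //.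
  rewrite (Vmul_castl _ (congr1 (+%R^~ t) (esym (addr0 r)))).
  rewrite (Vmul_castr _ (congr1 (+%R r) (esym (add0r t)))).
  rewrite (linZ (bounded_purel HT z hr ht).1) (linZ (bounded_purer HT x hr ht).1).
  symmetry; exact: cast_cast.
have [tp|t00] := pos _ t0; last first.
  subst t; apply: (reduce _ _ _ _ _ _ (dense_id hr) (dense_id hs) (dense_id ht)) => x y z.
  have [c <-] := us z.
  rewrite (Vmul0r _ (congr1 E (esym (addr0 s)))) // (Vmul0r _ (congr1 E (esym (addr0 (r + s))))) //.
  rewrite (Vmul_castr _ (congr1 (+%R r) (esym (addr0 s)))).
  rewrite (linZ (bounded_purer HT x hr hs).1) (linZ (Vmul_linear r0 s0)).
  symmetry; exact: cast_cast.
have rsp := addr_gt0 rp sp; have stp := addr_gt0 sp tp.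
have rstp := addr_gt0 rsp tp; have rstp' := addr_gt0 rp stp.
have [f _] := S0_inhabited rp; have [g _] := S0_inhabited sp; have [h _] := S0_inhabited tp.
have Sfg := S_tensor hS rp sp (svalP f) (svalP g); pose fg : S0 (r + s) := exist _ _ Sfg.
have Sgh := S_tensor hS sp tp (svalP g) (svalP h); pose gh : S0 (s + t) := exist _ _ Sgh.
have S1 := S_tensor hS rsp tp (svalP fg) (svalP h).
have S2 := S_tensor hS rp stp (svalP f) (svalP gh).
have [phi [hphi dphi]] := E_classes rp f; have [psi [hpsi dpsi]] := E_classes sp g.
have [chi [hchi dchi]] := E_classes tp h.
apply: (reduce _ _ _ _ _ _ dphi dpsi dchi) => a b c.
apply: (@Ecomp_inj _ rstp _ _ (exist _ _ S1)).
have L1 := Vmul_class rsp Sfg (hphi a) (hpsi b).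
rewrite (Vmul_class (f := fg) rstp S1 L1 (hchi c)).
have L2 := Vmul_class stp Sgh (hpsi b) (hchi c).
have L3 := Vmul_class (g := gh) rstp' S2 (hphi a) L2.
(* The right side is known at [f (x) (g (x) h)]. Moving it to the other bracketing costs the
   equality of the two states, which is what remains to be shown. *)
rewrite (Ecomp_cast rstp (F' := exist _ _ S1) _ L3) /=.
  by rewrite alg_cast_el el_at_assoc // addrA.
apply: (st_tensor_assoc hS) => //; try exact: svalP.
  by case: (S_normal hS rstp S1).
move=> a' b' c'; rewrite (st_tensorE hS rsp tp (svalP fg) (svalP h)).
by rewrite /= (st_tensorE hS rp sp (svalP f) (svalP g)).
Qed.

(** The rule fixes one component of each product of vectors, one component determines a vector of
    [E], and density of elementary tensors does the rest. *)
Lemma Vmul_unique (s t : R) (W : HT (E s) (E t) -> E (s + t)) : 0 < s -> 0 < t ->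
  bounded_op W -> multiplication_rule W -> W = @Vmul s t.
Proof.
move=> s0 t0 bW rW; have st0 := addr_gt0 s0 t0.
have hs := E_hilbert_pos s0; have ht := E_hilbert_pos t0.
have [f _] := S0_inhabited s0; have [g _] := S0_inhabited t0.
have Sfg := S_tensor hS s0 t0 (svalP f) (svalP g).
apply: (bounded_pure_eq hs ht (E_hilbert_pos st0) (dense_id hs) (dense_id ht) bW).
  exact: unitary_bounded (Vmul_unitary (ltW s0) (ltW t0)).
move=> x y; apply: (@Ecomp_inj _ st0 _ _ (exist _ _ Sfg)).
by rewrite (rW s0 t0 st0) (Vmul_rule s0 t0 s0 t0 st0).
Qed.

Lemma Vmul_product_system : is_product_system Vmul.
Proof.
apply: (@Build_is_product_system R HT E Vmul E_hilbert E_separable E0eq Vmul_unitary).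
- by move=> t t0 c x; exact: Vmul0l.
- by move=> t t0 c x; exact: Vmul0r.
- exact: Vmul_assoc.
Qed.

End ProductSystem.
Theorem proposition7p9 (R : realType) (HT : hilbert_tensor R)
    (WT : wstar_tensor HT) (GNS : gns_choice R) (B : ctps WT)
    (S : forall s t : R, set (B s t -> R[i]))
    (hS : stationary_factorizing GNS S)
    (U : forall (t : R) (f g : B 0 t -> R[i]), {linear gns GNS f -> gns GNS g})
    (U_unitary : forall (t : R) (f g : B 0 t -> R[i]),
       0 < t -> S 0 t f -> S 0 t g -> unitary_op (U t f g))
    (U_id : forall (t : R) (f : B 0 t -> R[i]),
       0 < t -> S 0 t f -> forall x, U t f f x = x)
    (U_comp : forall (t : R) (f g h : B 0 t -> R[i]),
       0 < t -> S 0 t f -> S 0 t g -> S 0 t h ->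
       forall x, U t g h (U t f g x) = U t f h x)
    (U_intertwines : forall (t : R) (f g : B 0 t -> R[i]),
       0 < t -> S 0 t f -> S 0 t g ->
       forall (a : B 0 t) (x : gns GNS f),
         U t f g (gns_pi a x) = gns_pi a (U t f g x))
    (U_factorizes : forall (s t : R) (f f' : B 0 s -> R[i]) (g g' : B 0 t -> R[i]),
       0 < s -> 0 < t -> S 0 s f -> S 0 s f' -> S 0 t g -> S 0 t g' ->
       forall x : HT (gns GNS f) (gns GNS g),
         U (s + t) (st_tensor f g) (st_tensor f' g') (gns_V x) =
         gns_V (ht_map (U s f f') (U t g g') x)) :
  exists V : forall s t : R,
      HT (Espace S U s) (Espace S U t) -> Espace S U (s + t),
    [/\ forall s t : R, 0 < s -> 0 < t -> multiplication_rule (V s t),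
        forall s t : R, 0 < s -> 0 < t ->
          forall W : HT (Espace S U s) (Espace S U t) -> Espace S U (s + t),
            bounded_op W -> multiplication_rule W -> W = V s t
      & is_product_system V].
Proof.
exists (@Vmul R HT WT GNS B S U); split.
- by move=> s t; exact: Vmul_rule.
- by move=> s t s0 t0 W; exact: Vmul_unique.
- exact: Vmul_product_system.
Qed.
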